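(* Let $\Bbbk$ be any field with $\mathrm{char}\,\Bbbk\neq 2$, let $n\ge 2$, let $f_0,\ldots,f_n\in\Bbbk[t]$ be nonzero polynomials with $\gcd(f_0,\ldots,f_n)=1$, and let $A_1,\ldots,A_n$ be free variables. Denote $K=\Bbbk(A_1,\ldots,A_n)$ and let $L$ be the splitting field over $K$ of $$F(t)=f_0(t)+\sum_{i=1}^nA_if_i(t)\in K[t].$$ Assume that the rational functions $f_i/f_j$, $0\le i,j\le n$, generate $\Bbbk(t)$ over $\Bbbk$ and that for some $i,j,k$ the Wronskian $W(f_i,f_j,f_k)$ does not vanish. Then $\mathrm{Gal}(L/K)=S_d$, where $d=\max_i\deg f_i$.
   Context: The Wronskian is $W(f,g,h)=\det\begin{pmatrix} f&g&h\\ f'&g'&h'\\ f''&g''&h''\end{pmatrix}$ (formal derivatives with respect to $t$); ''does not vanish'' means it is not the zero polynomial. $\mathrm{Gal}(L/K)=S_d$ means that the Galois group acts on the $d$ roots of $F$ as the full symmetric group. *)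

(* Defs.v *)
From HB Require Import structures.
From mathcomp Require Import all_boot all_order all_algebra all_fingroup all_solvable all_field.
From mathcomp Require Import mpoly.
Set Implicit Arguments.
Unset Strict Implicit.
Unset Printing Implicit Defensive.
Import GRing.Theory.
Local Open Scope ring_scope.

Definition wronskian (R : comNzRingType) (f g h : {poly R}) : {poly R} :=
  \det (\matrix_(a < 3, b < 3) ([:: f; g; h]`_b)^`(a)).

Definition ratfun (k : fieldType) : fieldType := {fraction {poly k}}.

Definition mratfun (n : nat) (k : fieldType) : fieldType :=
  {fraction {mpoly k[n]}}.

(* The subfield generated by the constants and E is Prop-valued, as membership
   in it is not decidable in general.                                         *)
Inductive generated_field (k : fieldType) (E : ratfun k -> Prop) :
    ratfun k -> Prop :=
| GenConst c : generated_field E (tofrac c%:P)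
| GenIncl x of E x : generated_field E x
| GenAdd x y of generated_field E x & generated_field E y :
    generated_field E (x + y)
| GenOpp x of generated_field E x : generated_field E (- x)
| GenMul x y of generated_field E x & generated_field E y :
    generated_field E (x * y)
| GenInv x of generated_field E x : generated_field E x^-1.

Definition ratios (k : fieldType) (n : nat) (f : 'I_n.+1 -> {poly k}) :
    ratfun k -> Prop :=
  fun x => exists i j, x = tofrac (f i) / tofrac (f j).

Definition mratC (n : nat) (k : fieldType) (c : k) : mratfun n k := tofrac c%:MP.

(* A_1, ..., A_n are the variables 'X_0, ..., 'X_(n-1), hence A_(i+1) = 'X_i is
   paired with f (lift ord0 i) = f_(i+1).                                     *)
Definition generic_comb (n : nat) (k : fieldType) (f : 'I_n.+1 -> {poly k}) :
    {poly mratfun n k} :=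
  map_poly (@mratC n k) (f ord0)
  + \sum_(i < n) tofrac ('X_i : {mpoly k[n]})
                   *: map_poly (@mratC n k) (f (lift ord0 i)).

(* p has exactly d roots in L, all simple, and the action of Gal(L/K) on them
   is an isomorphism onto 'S_d.                                               *)
Definition gal_full_symmetric (K : fieldType) (L : splittingFieldType K)
    (p : {poly L}) (d : nat) : Prop :=
  exists (rs : d.-tuple L) (phi : {morphism 'Gal({:L} / 1)%g >-> 'S_d}),
    [/\ uniq rs,
        p %= \prod_(z <- rs) ('X - z%:P),
        forall (g : gal_of {:L}) (i : 'I_d), g \in 'Gal({:L} / 1)%g ->
          g (tnth rs i) = tnth rs (phi g i)
      & isom 'Gal({:L} / 1)%g [set: 'S_d] phi].

(* Main.v *)
Require Import Defs.
From HB Require Import structures.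
From mathcomp Require Import all_boot all_order all_algebra all_fingroup all_solvable all_field.
From mathcomp Require Import mpoly.
From mathcomp Require Import ring.
From Stdlib Require Import Classical.
Set Implicit Arguments.
Unset Strict Implicit.
Unset Printing Implicit Defensive.
Import GRing.Theory.
Local Open Scope ring_scope.

(** Why the theorem holds.  After the reduction below there are two parameters
    [a], [b] over a domain [R], and [F = h0 + a h1 + b h2].  Think of
    [v = (h0, h1, h2)] as a parametrized plane curve: the roots of [F] are the
    parameters of the points where the curve meets the generic line, the one
    with equation [(1, a, b)].

    Two distinct roots [t1], [t2] span that line, so [a] and [b] are rational
    functions of [t1] and [t2]; counting transcendence degrees, [t1] and [t2]
    are independent ([mid_dif_indep]).  Therefore any two pairs of distinct roots
    are conjugate ([roots_2transitive]).  A double root would make the generic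
    line a tangent line, which depends on one parameter only; so [F] is
    separable ([incident_simple]).

    Put [t1 = s + u], [t2 = s - u]; this needs characteristic different from 2.
    As [u] tends to 0 the chord tends to the tangent line at the generic point
    [s], and the other roots of [F] become those of the tangent polynomial
    divided by [(t - s)^2].  This residual polynomial is separable
    ([tangent_separable]): the tangent is [N = v x v'], its derivative is
    [N' = v x v''], and [N x N' = W v] where [W] is the Wronskian.  At a second
    point of tangency [r] both [N] and [N'] vanish on [v(r)], so [v(r)] and
    [v(s)] are proportional, and [r = s] as the curve is birationally
    parametrized; but the contact at [s] is exactly double, since [W] does not
    vanish.

    So the other roots are unramified at [u = 0], while [u] itself is ramified
    over [u^2].  If the other roots told apart the elements of the stabilizer
    of the pair, the dual family of the unramified extension that they generate
    would express 1 as a multiple of [u] by an integral element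
    ([inertia_nontrivial]).  Hence a nontrivial element of the Galois group fixes
    all the other roots, and it is the transposition of [t1] and [t2]
    ([exists_transposition]).  All transpositions arise this way, and they
    generate the symmetric group ([full_symmetric_of_transpositions]).

    The reduction to two parameters keeps those whose polynomials occur in a
    nonzero Wronskian, and moves the others one at a time into the base domain
    ([full_symmetric_family]).  To be stable under this step, the hypotheses that
    the [f_i] are coprime and that their ratios generate the rational functions
    are restated in terms of points in arbitrary field extensions
    ([no_common_root], [separates_generic]). *)

(** * Evaluation morphisms and fraction fields *)

Fact ev_key : unit. Proof. exact: tt. Qed.

Section Evaluation.
Variables (R S : comNzRingType).

(** Sealed, so that comparing values in iterated fraction fields never unfolds
    them into Horner schemes. *)
Definition ev (f : {rmorphism R -> S}) (x : S) : {poly R} -> S :=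
  locked_with ev_key (fun p => (map_poly f p).[x]).

Lemma evE (f : {rmorphism R -> S}) x p : ev f x p = (map_poly f p).[x].
Proof. by rewrite /ev unlock. Qed.

Variables (f : {rmorphism R -> S}) (x : S).

Fact ev_is_zmod_morphism : zmod_morphism (ev f x).
Proof. by move=> p q; rewrite !evE rmorphB hornerD hornerN. Qed.

Fact ev_is_monoid_morphism : monoid_morphism (ev f x).
Proof. by split=> [|p q]; rewrite !evE ?rmorph1 ?hornerC // rmorphM hornerM. Qed.

HB.instance Definition _ :=
  GRing.isZmodMorphism.Build {poly R} S (ev f x) ev_is_zmod_morphism.
HB.instance Definition _ :=
  GRing.isMonoidMorphism.Build {poly R} S (ev f x) ev_is_monoid_morphism.

Lemma evC c : ev f x c%:P = f c.
Proof. by rewrite !evE map_polyC hornerC. Qed.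

Lemma evX : ev f x 'X = x.
Proof. by rewrite !evE map_polyX hornerX. Qed.

End Evaluation.

Lemma map_ev (R S T : comNzRingType) (f : {rmorphism R -> S})
    (g : {rmorphism S -> T}) x p : g (ev f x p) = ev (g \o f) (g x) p.
Proof. by rewrite !evE -horner_map -map_poly_comp. Qed.

Lemma ev_map (R S T : comNzRingType) (f : {rmorphism R -> S})
    (g : {rmorphism S -> T}) x p : ev g x (map_poly f p) = ev (g \o f) x p.
Proof. by rewrite !evE -map_poly_comp. Qed.

Lemma eq_ev (R S : comNzRingType) (f g : {rmorphism R -> S}) x : f =1 g -> ev f x =1 ev g x.
Proof. by move=> efg p; rewrite !evE (eq_map_poly efg). Qed.

Lemma pi_fracE (R : idomainType) (x : {ratio R}) :
  (\pi_{fraction R} x)%qT = tofrac \n_x / tofrac \d_x.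
Proof.
have d0 : tofrac \d_x != 0 by rewrite tofrac_eq0 denom_ratioP.
apply: (mulIf d0); rewrite divfK //.
unlock tofrac; rewrite -[LHS]FracField.pi_mul.
rewrite /FracField.mulf !numden_Ratio ?oner_eq0 //; apply/eqmodP.
rewrite /= FracField.equivfE !numden_Ratio ?mulr1 ?oner_eq0 ?denom_ratioP //.
by rewrite mulrC.
Qed.

Lemma fracE (R : idomainType) (x : {fraction R}) :
  exists a b, b != 0 /\ x = tofrac a / tofrac b.
Proof.
elim/quotP: x => x _; exists (\n_x), (\d_x).
by split; [exact: denom_ratioP | exact: pi_fracE].
Qed.

Lemma inj_rmorph_eq0 (R S : nzRingType) (f : {rmorphism R -> S}) :
  injective f -> forall a, (f a == 0) = (a == 0).
Proof. by move=> finj a; rewrite -(inj_eq finj) rmorph0. Qed.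

Section FractionLift.
Variables (R : idomainType) (F : fieldType) (f : {rmorphism R -> F}).
Hypothesis finj : injective f.

(** The extension of an embedding of a domain to its field of fractions; the
    injectivity proof is an argument so that the morphism structure can be
    inferred from the term alone. *)
Definition frac_lift of injective f := fun x : {fraction R} =>
  f (\n_(generic_quotient.repr x)) / f (\d_(generic_quotient.repr x)).

Local Notation g := (frac_lift finj).

Let f_eq0 := inj_rmorph_eq0 finj.

Lemma frac_lift_div a b : b != 0 -> g (tofrac a / tofrac b) = f a / f b.
Proof.
move=> b0; rewrite /frac_lift; set x := tofrac a / tofrac b.
have d0 := denom_ratioP (generic_quotient.repr x).
set n := \n_(generic_quotient.repr x); set d := \d_(generic_quotient.repr x).
have xE : x = tofrac n / tofrac d.
  have := reprK x; rewrite -{1}[generic_quotient.repr x]Ratio_numden => <-.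
  by rewrite Ratio_numden pi_fracE.
have : tofrac (n * b) == tofrac (a * d).
  by rewrite !rmorphM /= -eqr_div ?tofrac_eq0 // -xE eq_sym.
rewrite tofrac_eq => /eqP e.
by apply/eqP; rewrite eqr_div ?f_eq0 // -!rmorphM e.
Qed.

Lemma frac_lift_tofrac a : g (tofrac a) = f a.
Proof. by rewrite -[tofrac a]divr1 -tofrac1 frac_lift_div ?oner_eq0 // rmorph1 divr1. Qed.

Fact frac_lift_is_zmod_morphism : zmod_morphism g.
Proof.
move=> x y; have [a [b [b0 ->]]] := fracE x; have [c [d [d0 ->]]] := fracE y.
rewrite -mulNr -rmorphN addf_div ?tofrac_eq0 // -!rmorphM -rmorphD.
rewrite !frac_lift_div ?mulf_neq0 // rmorphD !rmorphM rmorphN.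
by rewrite -mulNr addf_div ?f_eq0.
Qed.

Fact frac_lift_is_monoid_morphism : monoid_morphism g.
Proof.
split=> [|x y]; first by rewrite -tofrac1 frac_lift_tofrac rmorph1.
have [a [b [b0 ->]]] := fracE x; have [c [d [d0 ->]]] := fracE y.
rewrite mulf_div -!rmorphM !frac_lift_div ?mulf_neq0 //.
by rewrite !rmorphM mulf_div.
Qed.

HB.instance Definition _ :=
  GRing.isZmodMorphism.Build {fraction R} F (frac_lift finj)
    frac_lift_is_zmod_morphism.
HB.instance Definition _ :=
  GRing.isMonoidMorphism.Build {fraction R} F (frac_lift finj)
    frac_lift_is_monoid_morphism.

End FractionLift.

Lemma poly_clear_denom (R : idomainType) (p : {poly {fraction R}}) :
  exists2 d : R, d != 0 &
  exists q : {poly R}, tofrac d *: p = map_poly (@tofrac R) q.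
Proof.
elim/poly_ind: p => [|p c [d d0 [q qE]]].
  by exists 1; [exact: oner_neq0 | exists 0; rewrite scaler0 rmorph0].
have [a [b [b0 ->]]] := fracE c.
exists (d * b); first by rewrite mulf_neq0.
exists (b *: q * 'X + (a * d)%:P).
rewrite [RHS]rmorphD [X in _ = X + _]rmorphM /= map_polyX map_polyC /=.
rewrite map_polyZ /= -qE !rmorphM /= scalerDr -!scalerAl scalerA.
rewrite [_ b * _ d]mulrC; congr (_ + _).
rewrite -mul_polyC -!polyCM; congr polyC.
by rewrite [_ b * _]mulrC -!mulrA [X in _ * X]mulrCA divff ?tofrac_eq0 // mulr1 mulrC.
Qed.

(** * Algebraic elements over a domain *)

Section AlgOver.
Variables (R : idomainType) (F : fieldType).

(** Algebraicity over the fraction field of the image of [f], without that field: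
    [R] will be an iterated polynomial ring whose variables are sent to chosen
    elements of [F]. *)
Definition alg_over (f : {rmorphism R -> F}) x := exists2 p : {poly R}, p != 0 & ev f x p = 0.

Variable f : {rmorphism R -> F}.
Hypothesis finj : injective f.

Lemma alg_over_fracP x : alg_over f x <-> integralOver (frac_lift finj) x.
Proof.
have fE : frac_lift finj \o (@tofrac R) =1 f by move=> a; apply: frac_lift_tofrac.
rewrite -integral_algebraic; split=> [] [p p0 px0].
  exists (map_poly (@tofrac R) p).
    rewrite map_poly_eq0_id0 // tofrac_eq0 lead_coef_eq0 //.
  by rewrite /root -map_poly_comp (eq_map_poly fE) -evE px0.
have [d d0 [q qE]] := poly_clear_denom p.
exists q.
  apply: contraNneq p0 => q0; move/eqP: qE.
  by rewrite q0 rmorph0 scaler_eq0 tofrac_eq0 (negPf d0).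
rewrite !evE -(eq_map_poly fE) map_poly_comp -qE map_polyZ hornerZ.
by rewrite (rootP px0) mulr0.
Qed.

Lemma alg_base a : alg_over f (f a).
Proof.
by apply/alg_over_fracP; rewrite -(frac_lift_tofrac finj); apply: integral_id.
Qed.

Lemma alg_add x y : alg_over f x -> alg_over f y -> alg_over f (x + y).
Proof.
by move=> /alg_over_fracP ax /alg_over_fracP ay; apply/alg_over_fracP/integral_add.
Qed.

Lemma alg_opp x : alg_over f x -> alg_over f (- x).
Proof. by move=> /alg_over_fracP ax; apply/alg_over_fracP/integral_opp. Qed.

Lemma alg_sub x y : alg_over f x -> alg_over f y -> alg_over f (x - y).
Proof. by move=> ax /alg_opp; apply: alg_add. Qed.

Lemma alg_mul x y : alg_over f x -> alg_over f y -> alg_over f (x * y).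
Proof.
by move=> /alg_over_fracP ax /alg_over_fracP ay; apply/alg_over_fracP/integral_mul.
Qed.

Lemma alg_inv x : alg_over f x -> alg_over f x^-1.
Proof. by move=> /alg_over_fracP ax; apply/alg_over_fracP/integral_inv. Qed.

Lemma alg_div x y : alg_over f x -> alg_over f y -> alg_over f (x / y).
Proof. by move=> ax /alg_inv; apply: alg_mul. Qed.

Lemma alg_root (p : {poly F}) x :
  p != 0 -> root p x -> (forall i, alg_over f p`_i) -> alg_over f x.
Proof.
move=> p0 px ap; apply/alg_over_fracP; apply: integral_root p0 px _.
by apply/integral_poly => i; apply/alg_over_fracP.
Qed.

Lemma alg_horner (p : {poly F}) x :
  (forall i, alg_over f p`_i) -> alg_over f x -> alg_over f p.[x].
Proof.
move=> ap /alg_over_fracP ax; apply/alg_over_fracP; apply: integral_horner ax.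
by apply/integral_poly => i; apply/alg_over_fracP.
Qed.

Lemma ev_inj x : ~ alg_over f x -> injective (ev f x).
Proof.
move=> tx; apply: raddf_inj => p px; apply/eqP/negPn/negP => p0.
by case: tx; exists p.
Qed.

End AlgOver.

Section AlgTransitivity.
Variables (R : idomainType) (F : fieldType) (f : {rmorphism R -> F}).
Hypothesis finj : injective f.

Lemma alg_trans (S : idomainType) (g : {rmorphism S -> F}) x : injective g ->
  (forall r, alg_over g (f r)) -> alg_over f x -> alg_over g x.
Proof.
move=> ginj ag [p p0 px]; apply: (@alg_root _ _ _ ginj (map_poly f p)).
- by rewrite map_poly_eq0_id0 // inj_rmorph_eq0 ?lead_coef_eq0.
- by rewrite /root -evE px.
- by move=> i; rewrite coef_map; apply: ag.
Qed.

Lemma alg_ev (S : idomainType) (g : {rmorphism S -> F}) x p : injective g ->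
  (forall r, alg_over g (f r)) -> alg_over g x -> alg_over g (ev f x p).
Proof.
by move=> ginj ag ax; rewrite evE; apply: alg_horner => // i; rewrite coef_map; apply: ag.
Qed.

End AlgTransitivity.

Section Transcendence.
Variables (R : idomainType) (F : fieldType) (f : {rmorphism R -> F}).
Hypothesis finj : injective f.

Lemma alg_over_self x : alg_over (ev f x) x.
Proof.
exists ('X - ('X)%:P); first by rewrite polyXsubC_eq0.
by rewrite rmorphB /= evX evC /= evX subrr.
Qed.

Lemma alg_over_evW x y : ~ alg_over f x -> alg_over f y -> alg_over (ev f x) y.
Proof.
move=> tx ay; apply: (alg_trans finj _ _ ay); first exact: ev_inj.
by move=> r; rewrite -(evC f x); apply/alg_base/ev_inj.
Qed.

Lemma ev_ev_swap x y (p : {poly {poly R}}) :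
  ev (ev f y) x (swapXY p) = ev (ev f x) y p.
Proof.
have evE2 u v (q : {poly {poly R}}) :
    ev (ev f u) v q = (map_poly (map_poly f) q).[v%:P].[u].
  rewrite evE -[RHS]/(horner_eval u _) -horner_map -map_poly_comp /= /horner_eval.
  by rewrite hornerC; congr (_.[v]); apply: eq_map_poly => w; rewrite /= evE.
by rewrite !evE2 -swapXY_map horner2_swapXY.
Qed.

(** Steinitz exchange, which is the symmetry of a polynomial relation. *)
Lemma alg_exchange x y :
  alg_over (ev f x) y -> alg_over (ev f y) x.
Proof.
by case=> p p0 pxy; exists (swapXY p); rewrite ?swapXY_eq0 // ev_ev_swap.
Qed.

(** Over the algebraic closure of [R(z)], of transcendence degree one, a
    transcendental [a] can replace [z] by exchange. *)
Lemma trdeg_le1 z a b : ~ alg_over f z -> alg_over (ev f z) a ->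
  alg_over (ev f z) b -> ~ alg_over f a -> alg_over (ev f a) b.
Proof.
move=> tz az bz ta; have ai := ev_inj ta.
apply: (alg_trans (ev_inj tz) ai _ bz) => p; apply: alg_ev => //.
  by move=> r; rewrite -(evC f a); apply: alg_base.
exact: alg_exchange.
Qed.

Definition indep2 a b := ~ alg_over f a /\ ~ alg_over (ev f a) b.

(** If [x] and [y] were dependent, everything algebraic over them, hence [a] and
    [b], would have transcendence degree at most one. *)
Lemma indep2_of_generated x y a b :
    (forall (S : idomainType) (g : {rmorphism S -> F}), injective g ->
      (forall r, alg_over g (f r)) -> alg_over g x -> alg_over g y ->
      alg_over g a /\ alg_over g b) ->
  indep2 a b -> indep2 x y.
Proof.
move=> gen [ta tb].
have base z : ~ alg_over f z -> forall r, alg_over (ev f z) (f r).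
  by move=> tz r; rewrite -(evC f z); apply/alg_base/ev_inj.
have contra z : ~ alg_over f z -> alg_over (ev f z) x ->
    alg_over (ev f z) y -> False.
  move=> tz xz yz; have [az bz] := gen _ _ (ev_inj tz) (base z tz) xz yz.
  by apply: tb; apply: trdeg_le1 az bz ta.
have [ax|tx] := classic (alg_over f x).
  have [ay|ty] := classic (alg_over f y).
    by have [] := gen _ _ finj (alg_base finj) ax ay.
  by case: (contra y ty); [exact: alg_over_evW | exact: alg_over_self].
split=> // ay; apply: (contra x tx) => //; exact: alg_over_self.
Qed.

End Transcendence.

(** * The dual curve *)

(** The rational map with coordinates [gs] is injective at a generic point [s]
    among points of all field extensions: a geometric form of birationality onto
    the image. *)
Definition separates_generic (R : idomainType) (gs : seq {poly R}) :=
  forall (F : fieldType) (f : {rmorphism R -> F}), injective f ->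
  forall s r : F, ~ alg_over f s ->
    (forall g h, g \in gs -> h \in gs ->
       ev f r g * ev f s h = ev f r h * ev f s g) -> r = s.

Definition no_common_root (R : idomainType) (gs : seq {poly R}) :=
  forall (F : fieldType) (f : {rmorphism R -> F}), injective f ->
  forall r : F, ~ (forall g, g \in gs -> ev f r g = 0).

Lemma deriv_lin3 (R : comNzRingType) (p q r : {poly R}) a b c :
  (p * a%:P + q * b%:P + r * c%:P)^`() = p^`() * a%:P + q^`() * b%:P + r^`() * c%:P.
Proof. by rewrite !derivD !derivM !derivC !mulr0 !addr0. Qed.

Lemma det_proportional (S : comNzRingType) (c0 c1 c2 h0 h1 h2 k0 k1 k2 l0 l1 l2 : S) :
    c0 * k1 = c1 * k0 -> c0 * k2 = c2 * k0 ->
    c0 * l1 = c1 * l0 -> c0 * l2 = c2 * l0 ->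
  c0 ^+ 2 * ((h1 * k2 - h2 * k1) * l0 + (h2 * k0 - h0 * k2) * l1 +
             (h0 * k1 - h1 * k0) * l2) = 0.
Proof.
move=> k01 k02 l01 l02.
rewrite [LHS](_ : _ =
  ((c0 * k1) * (c0 * l2) - (c0 * k2) * (c0 * l1)) * h0 +
  c0 * ((c0 * k2) * l0 - k0 * (c0 * l2)) * h1 +
  c0 * (k0 * (c0 * l1) - (c0 * k1) * l0) * h2); last by ring.
by rewrite k01 k02 l01 l02; ring.
Qed.

Section DualCurve.
Variables (R : idomainType) (h0 h1 h2 : {poly R}).

(** The tangent line [v x v'] of the curve [v = (h0, h1, h2)]. *)
Definition dual0 := h1 * h2^`() - h2 * h1^`().
Definition dual1 := h2 * h0^`() - h0 * h2^`().
Definition dual2 := h0 * h1^`() - h1 * h0^`().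

(** The Wronskian [det (v, v', v'')], written as the value of the tangent line on
    [v'']: its vanishing at a point means contact of order three. *)
Definition wr := dual0 * h0^`()^`() + dual1 * h1^`()^`() + dual2 * h2^`()^`().

Lemma deriv_dual0 : dual0^`() = h1 * h2^`()^`() - h2 * h1^`()^`().
Proof. by rewrite /dual0 derivB !derivM; ring. Qed.
Lemma deriv_dual1 : dual1^`() = h2 * h0^`()^`() - h0 * h2^`()^`().
Proof. by rewrite /dual1 derivB !derivM; ring. Qed.
Lemma deriv_dual2 : dual2^`() = h0 * h1^`()^`() - h1 * h0^`()^`().
Proof. by rewrite /dual2 derivB !derivM; ring. Qed.

Hypothesis wr_neq0 : wr != 0.

(** No fixed point lies on all tangent lines: it would lie on [v x v'] and on the
    derivative [v x v''], whose intersection is [v] because the Wronskian is not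
    zero; then [v] would be constant up to scaling. *)
Lemma dual_perp_const c0 c1 c2 :
  dual0 * c0%:P + dual1 * c1%:P + dual2 * c2%:P = 0 ->
  [/\ c0 = 0, c1 = 0 & c2 = 0].
Proof.
move=> e.
have e' : dual0^`() * c0%:P + dual1^`() * c1%:P + dual2^`() * c2%:P = 0.
  by rewrite -deriv_lin3 e raddf0.
move: e'; rewrite deriv_dual0 deriv_dual1 deriv_dual2 => e'.
have W0 p : wr * p = 0 -> p = 0.
  by move/eqP; rewrite mulf_eq0 (negPf wr_neq0) => /eqP.
have c01 : c0%:P * h1 = c1%:P * h0.
  apply/eqP; rewrite -subr_eq0; apply/eqP/W0.
  rewrite [LHS](_ : _ =
    dual2 * ((h1 * h2^`()^`() - h2 * h1^`()^`()) * c0%:P +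
             (h2 * h0^`()^`() - h0 * h2^`()^`()) * c1%:P +
             (h0 * h1^`()^`() - h1 * h0^`()^`()) * c2%:P) -
    (h0 * h1^`()^`() - h1 * h0^`()^`()) *
             (dual0 * c0%:P + dual1 * c1%:P + dual2 * c2%:P)).
    by rewrite e e' !mulr0 subrr.
  by rewrite /wr /dual0 /dual1 /dual2; ring.
have c02 : c0%:P * h2 = c2%:P * h0.
  apply/eqP; rewrite -subr_eq0; apply/eqP/W0.
  rewrite [LHS](_ : _ =
    (h2 * h0^`()^`() - h0 * h2^`()^`()) *
             (dual0 * c0%:P + dual1 * c1%:P + dual2 * c2%:P) -
    dual1 * ((h1 * h2^`()^`() - h2 * h1^`()^`()) * c0%:P +
             (h2 * h0^`()^`() - h0 * h2^`()^`()) * c1%:P +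
             (h0 * h1^`()^`() - h1 * h0^`()^`()) * c2%:P)).
    by rewrite e e' !mulr0 subrr.
  by rewrite /wr /dual0 /dual1 /dual2; ring.
have c12 : c1%:P * h2 = c2%:P * h1.
  apply/eqP; rewrite -subr_eq0; apply/eqP/W0.
  rewrite [LHS](_ : _ =
    dual0 * ((h1 * h2^`()^`() - h2 * h1^`()^`()) * c0%:P +
             (h2 * h0^`()^`() - h0 * h2^`()^`()) * c1%:P +
             (h0 * h1^`()^`() - h1 * h0^`()^`()) * c2%:P) -
    (h1 * h2^`()^`() - h2 * h1^`()^`()) *
             (dual0 * c0%:P + dual1 * c1%:P + dual2 * c2%:P)).
    by rewrite e e' !mulr0 subrr.
  by rewrite /wr /dual0 /dual1 /dual2; ring.
have dP c (p : {poly R}) : (c%:P * p)^`() = c%:P * p^`().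
  by rewrite derivM derivC mul0r add0r.
have dE c d (p q : {poly R}) : c%:P * p = d%:P * q -> c%:P * p^`() = d%:P * q^`().
  by rewrite -!dP => ->.
have W_eq0 c : c%:P ^+ 2 * wr = 0 -> c = 0.
  by rewrite mulrC => /W0/eqP; rewrite sqrf_eq0 polyC_eq0 => /eqP.
have [d01 d02 d12] := And3 (dE _ _ _ _ c01) (dE _ _ _ _ c02) (dE _ _ _ _ c12).
have [e01 e02 e12] := And3 (dE _ _ _ _ d01) (dE _ _ _ _ d02) (dE _ _ _ _ d12).
split; apply: W_eq0.
- exact: (det_proportional h0 h1 h2 d01 d02 e01 e02).
- rewrite -[RHS](det_proportional h1 h2 h0 d12 (esym d01) e12 (esym e01)).
  by rewrite /wr /dual0 /dual1 /dual2; ring.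
- rewrite -[RHS](det_proportional h2 h0 h1 (esym d02) (esym d12) (esym e02) (esym e12)).
  by rewrite /wr /dual0 /dual1 /dual2; ring.
Qed.

Section Point.
Variables (F : fieldType) (f : {rmorphism R -> F}).
Hypothesis finj : injective f.
Variables s r : F.
Hypothesis s_transc : ~ alg_over f s.

Lemma ev_neq0 (p : {poly R}) : p != 0 -> ev f s p != 0.
Proof. by move=> p0; rewrite (inj_rmorph_eq0 (ev_inj s_transc)). Qed.

(** Biduality: the tangent line and its derivative meet only in [v(s)]. *)
Lemma dual_point :
    ev f s dual0 * ev f r h0 + ev f s dual1 * ev f r h1
      + ev f s dual2 * ev f r h2 = 0 ->
    ev f s dual0^`() * ev f r h0 + ev f s dual1^`() * ev f r h1
      + ev f s dual2^`() * ev f r h2 = 0 ->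
  forall g h, g \in [:: h0; h1; h2] -> h \in [:: h0; h1; h2] ->
    ev f r g * ev f s h = ev f r h * ev f s g.
Proof.
have W0 := ev_neq0 wr_neq0; move: W0.
rewrite deriv_dual0 deriv_dual1 deriv_dual2 /wr /dual0 /dual1 /dual2.
rewrite !(rmorphB, rmorphD, rmorphM) /=.
set y0 := ev f s h0; set y1 := ev f s h1; set y2 := ev f s h2.
set y0' := ev f s h0^`(); set y1' := ev f s h1^`(); set y2' := ev f s h2^`().
set y0'' := ev f s h0^`()^`(); set y1'' := ev f s h1^`()^`().
set y2'' := ev f s h2^`()^`().
set x0 := ev f r h0; set x1 := ev f r h1; set x2 := ev f r h2.
set W := (X in X != 0); set A := (X in X = 0 -> _) => W0.
set B := (X in _ -> X = 0 -> _) => A0 B0.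
have c01 : x0 * y1 = x1 * y0.
  apply: (mulfI W0); apply/eqP; rewrite -subr_eq0; apply/eqP.
  rewrite [LHS](_ : _ = (y0 * y1' - y1 * y0') * B - (y0 * y1'' - y1 * y0'') * A).
    by rewrite A0 B0 !mulr0 subrr.
  by rewrite /W /A /B; ring.
have c02 : x0 * y2 = x2 * y0.
  apply: (mulfI W0); apply/eqP; rewrite -subr_eq0; apply/eqP.
  rewrite [LHS](_ : _ = (y2 * y0'' - y0 * y2'') * A - (y2 * y0' - y0 * y2') * B).
    by rewrite A0 B0 !mulr0 subrr.
  by rewrite /W /A /B; ring.
have c12 : x1 * y2 = x2 * y1.
  apply: (mulfI W0); apply/eqP; rewrite -subr_eq0; apply/eqP.
  rewrite [LHS](_ : _ = (y1 * y2' - y2 * y1') * B - (y1 * y2'' - y2 * y1'') * A).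
    by rewrite A0 B0 !mulr0 subrr.
  by rewrite /W /A /B; ring.
move=> g h; rewrite !inE => /or3P[] /eqP-> /or3P[] /eqP-> //=.
Qed.

(** The incidence of [r] with the tangent at [s] is a polynomial relation for [s]
    with coefficients in [R[r]]; as [s] is transcendental, the relation is
    trivial and can be differentiated. *)
Lemma dual_alg_point : alg_over f r ->
    ev f s dual0 * ev f r h0 + ev f s dual1 * ev f r h1
      + ev f s dual2 * ev f r h2 = 0 ->
    ev f s dual0^`() * ev f r h0 + ev f s dual1^`() * ev f r h1
      + ev f s dual2^`() * ev f r h2 = 0.
Proof.
move=> ar e; pose p := ev f r h0 *: map_poly f dual0 +
  ev f r h1 *: map_poly f dual1 + ev f r h2 *: map_poly f dual2.
have p0 : p = 0.
  apply/eqP/negPn/negP => p0; apply: s_transc; apply: (alg_root finj p0).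
    by rewrite /root /p !hornerE -e !evE; apply/eqP; ring.
  have ah h : alg_over f (ev f r h).
    by apply: alg_ev => // a; apply: alg_base.
  move=> i; rewrite /p !(coefD, coefZ, coef_map) /=.
  by do ?[apply: (alg_add finj)]; apply: (alg_mul finj) => //; apply: alg_base.
have pE : p^`() = ev f r h0 *: map_poly f dual0^`() +
    ev f r h1 *: map_poly f dual1^`() + ev f r h2 *: map_poly f dual2^`().
  by rewrite /p derivD derivD !derivZ !deriv_map.
have := congr1 (fun q => q.[s]) pE; rewrite p0 deriv0 horner0 /= => e0.
by rewrite [RHS]e0 !hornerE !evE; ring.
Qed.

(** A line of contact order three at [r] annihilates the three rows of the
    Wronskian at [r]. *)
Lemma dual_flex :
    ev f s dual0 * ev f r h0 + ev f s dual1 * ev f r h1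
      + ev f s dual2 * ev f r h2 = 0 ->
    ev f s dual0 * ev f r h0^`() + ev f s dual1 * ev f r h1^`()
      + ev f s dual2 * ev f r h2^`() = 0 ->
    ev f s dual0 * ev f r h0^`()^`() + ev f s dual1 * ev f r h1^`()^`()
      + ev f s dual2 * ev f r h2^`()^`() = 0 ->
  alg_over f r.
Proof.
move=> A0 B0 C0; exists wr => //.
have [e|n0] := boolP [&& ev f s dual0 == 0, ev f s dual1 == 0 & ev f s dual2 == 0].
  have := ev_neq0 wr_neq0; case/and3P: e => /eqP n0 /eqP n1 /eqP n2.
  by rewrite /wr !rmorphD !rmorphM /= n0 n1 n2 !mul0r !addr0 eqxx.
have W0 d : d != 0 -> d * ev f r wr = 0 -> ev f r wr = 0.
  by move=> d0 /eqP; rewrite mulf_eq0 (negPf d0) => /eqP.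
move: n0 A0 B0 C0 W0.
move: (ev f s dual0) (ev f s dual1) (ev f s dual2) => d0 d1 d2.
rewrite /wr /dual0 /dual1 /dual2 !(rmorphB, rmorphD, rmorphM) /=.
set x0 := ev f r h0; set x1 := ev f r h1; set x2 := ev f r h2.
set x0' := ev f r h0^`(); set x1' := ev f r h1^`(); set x2' := ev f r h2^`().
set x0'' := ev f r h0^`()^`(); set x1'' := ev f r h1^`()^`().
set x2'' := ev f r h2^`()^`().
set A := d0 * x0 + _ + _; set B := d0 * x0' + _ + _; set C := d0 * x0'' + _ + _.
move=> n0 A0 B0 C0 W0; move: n0; rewrite !negb_and => /or3P[] /W0; apply.
- rewrite [LHS](_ : _ = A * (x1' * x2'' - x2' * x1'') +
    B * (x1'' * x2 - x2'' * x1) + C * (x1 * x2' - x2 * x1')).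
    by rewrite A0 B0 C0 !mul0r !addr0.
  by rewrite /A /B /C; ring.
- rewrite [LHS](_ : _ = A * (x2' * x0'' - x0' * x2'') +
    B * (x2'' * x0 - x0'' * x2) + C * (x2 * x0' - x0 * x2')).
    by rewrite A0 B0 C0 !mul0r !addr0.
  by rewrite /A /B /C; ring.
- rewrite [LHS](_ : _ = A * (x0' * x1'' - x1' * x0'') +
    B * (x0'' * x1 - x1'' * x0) + C * (x0 * x1' - x1 * x0')).
    by rewrite A0 B0 C0 !mul0r !addr0.
  by rewrite /A /B /C; ring.
Qed.

End Point.
End DualCurve.

(** * The residual polynomial of a generic tangent *)

Lemma irreducible_factor (F : fieldType) (p : {poly F}) : size p != 1 ->
  exists2 m, irreducible_poly m & m %| p.
Proof.
have [n] := ubnP (size p); elim: n p => // n IHn p; rewrite ltnS => lepn p1.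
have [p0|p0] := eqVneq p 0.
  by exists ('X - 0%:P); rewrite ?p0 ?dvdp0 //; apply: irredp_XsubC.
have [irr|] := classic (irreducible_poly p); first by exists p.
have p_gt1 : (1 < size p)%N.
  by move: p1 p0; rewrite -size_poly_eq0; case: (size p) => [|[]].
move=> nirr.
have ex_q : exists q : {poly F}, ~ (size q != 1 -> q %| p -> q %= p).
  by apply: not_all_ex_not => h; apply: nirr; split.
have [q nq] := ex_q; have [q1 nq1] := imply_to_and _ _ nq.
have [qp nqp] := imply_to_and _ _ nq1.
have ltqp : (size q < size p)%N.
  rewrite ltn_neqAle (dvdp_leq p0 qp) andbT; apply: contra_notN nqp.
  by move=> e; rewrite -(dvdp_size_eqp qp).
have [m irr mq] := IHn q (leq_trans ltqp lepn) q1.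
by exists m => //; apply: dvdp_trans qp.
Qed.

Section CoefDeriv.
Variable R : comNzRingType.

(** The derivation along the coefficients: for polynomials in [t] over [R[s]], the
    partial derivative with respect to [s]. *)
Definition coef_deriv := map_poly (@deriv R).

Lemma coef_derivM p q : coef_deriv (p * q) = coef_deriv p * q + p * coef_deriv q.
Proof.
apply/polyP => i; rewrite coefD !coefM coef_map coefM raddf_sum -big_split /=.
by apply: eq_bigr => j _; rewrite derivM !coef_map.
Qed.

Lemma coef_derivZ c p : coef_deriv (c *: p) = c^`() *: p + c *: coef_deriv p.
Proof. by apply/polyP => i; rewrite !(coefD, coefZ, coef_map) /= derivM. Qed.

Lemma coef_deriv_polyC (p : {poly R}) : coef_deriv (map_poly polyC p) = 0.
Proof. by apply/polyP => i; rewrite !coef_map /= derivC coef0. Qed.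

Lemma coef_derivD p q : coef_deriv (p + q) = coef_deriv p + coef_deriv q.
Proof. exact: raddfD. Qed.

End CoefDeriv.

Lemma map_lin3 (R S : comNzRingType) (g : {rmorphism R -> S}) p0 p1 p2 q0 q1 q2 :
  map_poly g (p0 *: q0 + p1 *: q1 + p2 *: q2) =
  g p0 *: map_poly g q0 + g p1 *: map_poly g q1 + g p2 *: map_poly g q2.
Proof. by rewrite !rmorphD /= !map_polyZ. Qed.

Section Tangent.
Variables (R : idomainType) (h0 h1 h2 : {poly R}).
Hypothesis wr_neq0 : wr h0 h1 h2 != 0.
Hypothesis sep : separates_generic [:: h0; h1; h2].

Local Notation E := {fraction {poly R}}.
Local Notation d0 := (dual0 h1 h2).
Local Notation d1 := (dual1 h0 h2).
Local Notation d2 := (dual2 h0 h1).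

Definition cst : R -> E := @tofrac _ \o polyC.
HB.instance Definition _ := GRing.RMorphism.copy cst (@tofrac {poly R} \o polyC).
Definition gen : E := tofrac 'X.

Lemma cst_inj : injective cst.
Proof. by move=> a b /eqP; rewrite /cst /= tofrac_eq => /eqP/polyC_inj. Qed.

Lemma ev_gen (F : fieldType) (g : {rmorphism E -> F}) p :
  ev (g \o cst) (g gen) p = g (tofrac p).
Proof.
rewrite -map_ev; congr (g _); rewrite -[in RHS](comp_polyXr p).
rewrite !evE /gen map_poly_comp horner_map.
by rewrite /comp_poly /=.
Qed.

(** The tangent line at the generic point [s], restricted to the curve. *)
Definition tangent : {poly E} := tofrac d0 *: map_poly cst h0 +
  tofrac d1 *: map_poly cst h1 + tofrac d2 *: map_poly cst h2.

Lemma deriv_tangent : tangent^`() = tofrac d0 *: map_poly cst h0^`() +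
  tofrac d1 *: map_poly cst h1^`() + tofrac d2 *: map_poly cst h2^`().
Proof. by rewrite /tangent derivD derivD !derivZ !deriv_map. Qed.

Lemma deriv2_tangent : tangent^`()^`() = tofrac d0 *: map_poly cst h0^`()^`() +
  tofrac d1 *: map_poly cst h1^`()^`() + tofrac d2 *: map_poly cst h2^`()^`().
Proof. by rewrite deriv_tangent derivD derivD !derivZ !deriv_map. Qed.

Lemma mulr_sqM (S : comNzRingType) (a b m q : S) :
  a ^+ 2 * b * (m ^+ 2 * q) = (a * m) * ((a * m) * (b * q)).
Proof. by ring. Qed.

Lemma mulr_sq_swap (S : comNzRingType) (x q m : S) :
  x * (q * m * m) = m ^+ 2 * (x * q).
Proof. by ring. Qed.

Lemma deriv2_sqM (S : comNzRingType) x (G : {poly S}) :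
  ((('X - x%:P) ^+ 2 * G)^`()^`()).[x] = G.[x] *+ 2.
Proof.
rewrite expr2 !(derivM, derivD, derivB, derivX, derivC, subr0) !(hornerE, derivC, derivE) /= subrr.
by rewrite !(mul0r, mulr0, addr0, add0r, subr0, mulr1) mulrDl mul1r mulr2n.
Qed.

Section TangentPoint.
Variables (F : fieldType) (g : {rmorphism E -> F}) (r : F).
Local Notation f := (g \o cst).
Local Notation s := (g gen).

Lemma inj_ext : injective f.
Proof. by move=> a b /fmorph_inj/cst_inj. Qed.

Lemma gen_transc : ~ alg_over f s.
Proof.
by case=> p p0 /eqP; rewrite ev_gen fmorph_eq0 tofrac_eq0 (negPf p0).
Qed.

Lemma horner_lin3 (p0 p1 p2 q0 q1 q2 : {poly R}) :
  (map_poly g (tofrac p0 *: map_poly cst q0 + tofrac p1 *: map_poly cst q1 +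
               tofrac p2 *: map_poly cst q2)).[r] =
  ev f s p0 * ev f r q0 + ev f s p1 * ev f r q1 + ev f s p2 * ev f r q2.
Proof.
rewrite !ev_gen map_lin3 !hornerD !hornerZ.
by rewrite !evE -!(map_poly_comp g cst).
Qed.

(** Differentiating [tangent = m^2 q] with respect to [s] leaves a multiple of [m];
    denominators are cleared so that only polynomials are differentiated. *)
Lemma tangent_double_factor (m q : {poly E}) : tangent = m ^+ 2 * q ->
    (map_poly g m).[r] = 0 ->
  ev f s d0^`() * ev f r h0 + ev f s d1^`() * ev f r h1
    + ev f s d2^`() * ev f r h2 = 0.
Proof.
move=> Tmq mr.
have [a a0 [m1 m1E]] := poly_clear_denom m.
have [b b0 [q1 q1E]] := poly_clear_denom q.
pose T := d0 *: map_poly polyC h0 + d1 *: map_poly polyC h1 +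
          d2 *: map_poly polyC h2.
have TE : map_poly (@tofrac {poly R}) T = tangent.
  by rewrite /T /tangent map_lin3 -!map_poly_comp.
have eqT : (a ^+ 2 * b) *: T = m1 * (m1 * q1).
  apply: (@map_inj_poly _ _ (@tofrac {poly R})).
  - by move=> x y /eqP; rewrite tofrac_eq => /eqP.
  - exact: rmorph0.
  rewrite map_polyZ /= TE ![in RHS]rmorphM /= -m1E -q1E Tmq -!mul_polyC.
  by rewrite rmorphM rmorphXn polyCM polyC_exp /= mulr_sqM.
pose e := ev (ev f s) r.
have eC c : e (map_poly polyC c) = ev f r c.
  rewrite /e ev_map; apply: eq_ev => x /=; exact: evC.
have eZ (c : {poly R}) p : e (c *: p) = ev f s c * e p.
  by rewrite -mul_polyC /e rmorphM /= evC.
have eD p p' : e (p + p') = e p + e p' by exact: rmorphD.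
have eM p p' : e (p * p') = e p * e p' by exact: rmorphM.
have em1 : e m1 = 0.
  rewrite /e; have -> : ev (ev f s) r m1 = (map_poly g (map_poly (@tofrac _) m1)).[r].
    by rewrite -map_poly_comp -evE; apply: eq_ev => p; exact: ev_gen.
  by rewrite -m1E map_polyZ hornerZ mr mulr0.
have eT : e T = 0.
  have := congr1 e eqT; rewrite eZ [RHS]rmorphM /= -/e em1 mul0r => /eqP.
  rewrite mulf_eq0 => /orP[|/eqP//].
  by rewrite ev_gen fmorph_eq0 tofrac_eq0 mulf_eq0 expf_eq0 /= (negPf a0) (negPf b0).
have eT' : e (coef_deriv T) = 0.
  have := congr1 (e \o @coef_deriv R) eqT.
  rewrite /= coef_derivZ coef_derivM !eD !eZ !eM eT em1 !mul0r !mulr0 !addr0 add0r.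
  move=> /eqP; rewrite mulf_eq0 => /orP[|/eqP//].
  by rewrite ev_gen fmorph_eq0 tofrac_eq0 mulf_eq0 expf_eq0 /= (negPf a0) (negPf b0).
rewrite -[RHS]eT' /T !coef_derivD !coef_derivZ !coef_deriv_polyC !scaler0 !addr0.
by rewrite !eD !eZ !eC.
Qed.

End TangentPoint.

(** Let [r] be a common root of [G] and its derivative, with irreducible factor [m].
    If [m^2] divides the tangent, the derivative along [s] vanishes at [r].
    Otherwise [m] is inseparable, so all derivatives of order at most two vanish
    at [r]; then [r] is a flex, hence algebraic over [R], and again the derivative
    along [s] vanishes.  In both cases biduality gives [r = s], against the
    contact of order exactly two at [s]. *)
Lemma tangent_separable G : ('X - gen%:P) ^+ 2 * G = tangent ->
  coprimep G G^`().
Proof.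
move=> TG; apply/negPn/negP => ncop.
have [m irr] := irreducible_factor ncop.
rewrite dvdp_gcd => /andP[mG mG'].
have [Om _ [z mz _]] := irredp_FAdjoin irr.
pose g : {rmorphism E -> Om} := in_alg Om.
have {}mz : (map_poly g m).[z] = 0 by apply/rootP.
have m_dvd p : m %| p -> (map_poly g p).[z] = 0.
  by case/dvdpP => q ->; rewrite rmorphM /= hornerM mz mulr0.
have finj : injective (g \o cst) by exact: inj_ext.
have strans : ~ alg_over (g \o cst) (g gen) by exact: gen_transc.
have A0 : (map_poly g tangent).[z] = 0.
  by apply: m_dvd; rewrite -TG dvdp_mull.
rewrite horner_lin3 in A0.
have B0 : ev (g \o cst) (g gen) d0^`() * ev (g \o cst) z h0 +
    ev (g \o cst) (g gen) d1^`() * ev (g \o cst) z h1 +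
    ev (g \o cst) (g gen) d2^`() * ev (g \o cst) z h2 = 0.
  have /dvdpP[q Gqm] := mG.
  have [mq|nmq] := boolP (m %| q).
    have /dvdpP[q' qE] := mq.
    apply: (@tangent_double_factor _ g z m (('X - gen%:P) ^+ 2 * q') _ mz).
    by rewrite -TG Gqm qE mulr_sq_swap.
  have m'0 : m^`() = 0.
    have cop : coprimep m q.
      have [g1|gm] := irredp_XsubCP irr (dvdp_gcdl m q).
        by rewrite -size_poly_eq1 in g1.
      by case/negP: nmq; rewrite -(eqp_dvdl _ gm) dvdp_gcdr.
    have : m %| m^`().
      move: mG'; rewrite Gqm derivM (dvdp_addr _ (dvdp_mull _ (dvdpp m))).
      by rewrite Gauss_dvdpr.
    apply: contraTeq => m'n0.
    by rewrite gtNdvdp // lt_size_deriv // irredp_neq0.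
  have TE : tangent = ('X - gen%:P) ^+ 2 * q * m by rewrite -TG Gqm mulrA.
  apply: (dual_alg_point finj strans _ A0).
  apply: (dual_flex wr_neq0 strans A0).
    rewrite -horner_lin3 -deriv_tangent; apply: m_dvd.
    by rewrite TE derivM m'0 mulr0 addr0 dvdp_mull.
  rewrite -horner_lin3 -deriv2_tangent; apply: m_dvd.
  by rewrite TE derivM m'0 mulr0 addr0 derivM m'0 mulr0 addr0 dvdp_mull.
have zE : z = g gen.
  by apply: (sep finj strans); apply: dual_point A0 B0.
have G0 : G.[gen] = 0.
  by apply: (fmorph_inj g); rewrite -horner_map -zE m_dvd // rmorph0.
have /eqP := ev_neq0 strans wr_neq0; apply.
rewrite /wr !rmorphD !rmorphM /= -horner_lin3 -deriv2_tangent horner_map.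
by rewrite -TG deriv2_sqM G0 mul0rn rmorph0.
Qed.

End Tangent.

(** * The generic pair of roots *)

Lemma rmorph_minor (R S : nzRingType) (g : {rmorphism R -> S}) x y z w :
  g (x * y - z * w) = g x * g y - g z * g w.
Proof. by rewrite rmorphB !rmorphM. Qed.

Section GenericPair.
Variables (R : idomainType) (h0 h1 h2 : {poly R}).
Local Notation E := {fraction {poly R}}.

Definition cstP : R -> {poly E} := polyC \o @cst R.
HB.instance Definition _ := GRing.RMorphism.copy cstP (polyC \o @cst R).

(** The ends [s + u] and [s - u] of a generic chord, where [E = R(s)] and [u] is the
    variable. Sealed, because comparing the two would unfold fraction arithmetic. *)
Definition pt1 : {poly E} := locked ((gen R)%:P + 'X).
Definition pt2 : {poly E} := locked ((gen R)%:P - 'X).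

Definition at1 (h : {poly R}) : {poly E} := ev cstP pt1 h.
Definition at2 (h : {poly R}) : {poly E} := ev cstP pt2 h.

(** The line [v(s + u) x v(s - u)]. *)
Definition chord0 := at1 h1 * at2 h2 - at1 h2 * at2 h1.
Definition chord1 := at1 h2 * at2 h0 - at1 h0 * at2 h2.
Definition chord2 := at1 h0 * at2 h1 - at1 h1 * at2 h0.

Local Notation Q := {fraction {poly E}}.

Definition cstQ : R -> Q := @tofrac {poly E} \o cstP.
HB.instance Definition _ := GRing.RMorphism.copy cstQ (@tofrac {poly E} \o cstP).

(** The generic chord normalized to first coordinate 1: the coefficients [a], [b]
    as functions of [s] and [u]. *)
Definition coefQ1 : Q := tofrac chord1 / tofrac chord0.
Definition coefQ2 : Q := tofrac chord2 / tofrac chord0.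

End GenericPair.

(** * Roots of the generic combination *)

Section Roots.
Variables (R : idomainType) (F : fieldType) (j : {rmorphism R -> F}).
Hypothesis jinj : injective j.
Variables (a b : F) (h0 h1 h2 : {poly R}).
Hypothesis ab_indep : indep2 j a b.
Hypothesis wr_neq0 : wr h0 h1 h2 != 0.
Hypothesis sep : separates_generic [:: h0; h1; h2].
Hypothesis ncr : no_common_root [:: h0; h1; h2].

(** The point of parameter [r] lies on the line [(1, a, b)]. *)
Definition incident r := ev j r h0 + a * ev j r h1 + b * ev j r h2 = 0.

(** A point with coordinates algebraic over [R] is not on the generic line. *)
Lemma indep_lin c0 c1 c2 : alg_over j c0 -> alg_over j c1 -> alg_over j c2 ->
  c0 + a * c1 + b * c2 = 0 -> [/\ c0 = 0, c1 = 0 & c2 = 0].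
Proof.
have [ta tb] := ab_indep; move=> a0 a1 a2 e.
have e2 : c2 = 0.
  apply/eqP/negPn/negP => n2; apply: tb.
  have -> : b = - (c0 + a * c1) / c2.
    by apply: (mulIf n2); rewrite divfK //; apply/eqP; rewrite -addr_eq0 addrC e.
  have ai := ev_inj ta.
  apply: (alg_div ai); last exact: alg_over_evW.
  apply: (alg_opp ai); apply: (alg_add ai); first exact: alg_over_evW.
  by apply: (alg_mul ai); [exact: alg_over_self | exact: alg_over_evW].
move: (e); rewrite e2 mulr0 addr0 => e'.
have e1 : c1 = 0.
  apply/eqP/negPn/negP => n1; apply: ta.
  have -> : a = - c0 / c1.
    apply: (mulIf n1); rewrite divfK //; apply/eqP; rewrite -addr_eq0 addrC.
    by rewrite e'.
  by apply: (alg_div jinj) => //; apply: (alg_opp jinj).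
by split=> //; rewrite -e e1 e2 !mulr0 !addr0.
Qed.

Lemma alg_ev_base r h : alg_over j r -> alg_over j (ev j r h).
Proof. by move=> ar; apply: alg_ev => // x; apply: alg_base. Qed.

Lemma incident_transc r : incident r -> ~ alg_over j r.
Proof.
move=> e ar; apply: (ncr jinj (r := r)) => g.
have [e0 e1 e2] := indep_lin (alg_ev_base h0 ar) (alg_ev_base h1 ar)
                             (alg_ev_base h2 ar) e.
by rewrite !inE => /or3P[] /eqP->.
Qed.

(** The line through two points is their cross product, up to scaling. *)
Lemma perp_cross (y0 y1 y2 z0 z1 z2 : F) :
    y0 + a * y1 + b * y2 = 0 -> z0 + a * z1 + b * z2 = 0 ->
  (y2 * z0 - y0 * z2 = a * (y1 * z2 - y2 * z1)) *
  (y0 * z1 - y1 * z0 = b * (y1 * z2 - y2 * z1)).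
Proof.
move=> ey ez.
have -> : y0 = - (a * y1 + b * y2) by apply/eqP; rewrite -addr_eq0 addrA ey.
have -> : z0 = - (a * z1 + b * z2) by apply/eqP; rewrite -addr_eq0 addrA ez.
by split; ring.
Qed.

(** First coordinate of the line through the points of parameters [r] and [r']. *)
Definition minor r r' := ev j r h1 * ev j r' h2 - ev j r h2 * ev j r' h1.

(** Otherwise the two points would be equal, as both are on the generic line, and
    the parametrization would not separate generic points. *)
Lemma minor_neq0 r r' : incident r -> incident r' -> r != r' -> minor r r' != 0.
Proof.
move=> ir ir'; apply: contraNneq => m0; apply/eqP.
have [e20 e01] := perp_cross ir ir'.
rewrite -/(minor r r') m0 mulr0 in e20; rewrite -/(minor r r') m0 mulr0 in e01.
move: m0 e20 e01 => /subr0_eq e12 /subr0_eq e20 /subr0_eq e01.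
apply: (sep jinj (incident_transc ir')) => g h.
have e12' := esym e12; have e20' := esym e20; have e01' := esym e01.
rewrite !inE => /or3P[] /eqP-> /or3P[] /eqP-> //;
  rewrite [LHS]mulrC [RHS]mulrC.
Qed.

(** At a double root the covector [(1, a, b)] would be the tangent line at that
    root, hence would depend on one parameter only. *)
Lemma incident_simple r : incident r ->
  ev j r h0^`() + a * ev j r h1^`() + b * ev j r h2^`() <> 0.
Proof.
move=> ir ir'; have tr := incident_transc ir.
have [e20 e01] := perp_cross ir ir'.
have n0 : ev j r h1 * ev j r h2^`() - ev j r h2 * ev j r h1^`() != 0.
  apply: contraNneq (ev_neq0 tr wr_neq0) => n0; rewrite n0 !mulr0 in e20 e01.
  by rewrite /wr /dual0 /dual1 /dual2 !(rmorphB, rmorphD, rmorphM) /=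
             n0 e20 e01 !mul0r !addr0.
(* Otherwise [a] and [b] are rational in [r], and [r] is independent of 0. *)
have [//|_ []] := @indep2_of_generated _ _ j jinj r 0 a b _ ab_indep; last first.
  by rewrite -(rmorph0 (ev j r)); apply/alg_base/ev_inj.
move=> S g ginj gj gr _.
have ge h : alg_over g (ev j r h) by apply: alg_ev.
have gm c0 c1 c2 c3 : alg_over g (ev j r c0 * ev j r c1 - ev j r c2 * ev j r c3).
  by apply: (alg_sub ginj); apply: (alg_mul ginj).
split.
  rewrite -[a](mulfK n0) -e20; exact: (alg_div ginj).
by rewrite -[b](mulfK n0) -e01; exact: (alg_div ginj).
Qed.

Section Pair.
Hypothesis two_neq0 : 2%:R != 0 :> F.
Variables t t' : F.
Definition distinct_roots := [/\ incident t, incident t' & t != t'].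
Hypothesis dr : distinct_roots.

Definition mid := (t + t') / 2%:R.
Definition dif := (t - t') / 2%:R.

Lemma mid_add_dif : mid + dif = t.
Proof. by apply: (mulIf two_neq0); rewrite mulrDl !divfK //; ring. Qed.

Lemma mid_sub_dif : mid - dif = t'.
Proof.
by apply: (mulIf two_neq0); rewrite mulrBl !divfK //; ring.
Qed.

Lemma pair_minor_neq0 : minor t t' != 0.
Proof. by case: dr => it it' ntt'; apply: minor_neq0. Qed.

(** [a] and [b] are rational in the two roots, so the roots have transcendence
    degree two. *)
Lemma mid_dif_indep : indep2 j mid dif.
Proof.
have [it it' ntt'] := dr; have [e20 e01] := perp_cross it it'.
apply: (indep2_of_generated jinj _ ab_indep) => S g ginj gj gm gd.
have gt : alg_over g t by rewrite -mid_add_dif; exact: (alg_add ginj gm gd).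
have gt' : alg_over g t' by rewrite -mid_sub_dif; exact: (alg_sub ginj gm gd).
have ge h : alg_over g (ev j t h) by apply: alg_ev.
have ge' h : alg_over g (ev j t' h) by apply: alg_ev.
have gm' c0 c1 c2 c3 : alg_over g (ev j t c0 * ev j t' c1 - ev j t c2 * ev j t' c3).
  by apply: (alg_sub ginj); apply: (alg_mul ginj).
split.
  by rewrite -[a](mulfK pair_minor_neq0) -e20; apply: (alg_div ginj); exact: gm'.
by rewrite -[b](mulfK pair_minor_neq0) -e01; apply: (alg_div ginj); exact: gm'.
Qed.

Lemma mid_inj : injective (ev j mid).
Proof. by apply: ev_inj; case: mid_dif_indep. Qed.

(** The embeddings of [R(s)] and [R(s, u)] that send the generic chord to the one
    through the roots [t] and [t']. *)
Definition lamE : {fraction {poly R}} -> F := frac_lift mid_inj.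
HB.instance Definition _ := GRing.RMorphism.on lamE.

Lemma lamE_cst x : lamE (cst x) = j x.
Proof. by rewrite /lamE /cst /= frac_lift_tofrac /= evC. Qed.

Lemma lamE_gen : lamE (gen R) = mid.
Proof. by rewrite /lamE /gen /= frac_lift_tofrac /= evX. Qed.

Lemma dif_transc : ~ alg_over lamE dif.
Proof.
case: mid_dif_indep => _ td au; apply: td.
by apply/(alg_over_fracP mid_inj)/integral_algebraic; case: au => p p0 pu;
   exists p => //; rewrite /root -evE pu.
Qed.

Lemma dif_inj : injective (ev lamE dif).
Proof. exact: ev_inj dif_transc. Qed.

Definition lam : {fraction {poly {fraction {poly R}}}} -> F := frac_lift dif_inj.
HB.instance Definition _ := GRing.RMorphism.on lam.

Lemma lam_tofrac p : lam (tofrac p) = ev lamE dif p.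
Proof. exact: frac_lift_tofrac. Qed.

Lemma ev_pt1 : ev lamE dif (pt1 R) = t.
Proof. by rewrite /pt1 -lock rmorphD /= evC evX /= lamE_gen mid_add_dif. Qed.

Lemma ev_pt2 : ev lamE dif (pt2 R) = t'.
Proof. by rewrite /pt2 -lock rmorphB /= evC evX /= lamE_gen mid_sub_dif. Qed.

Lemma ev_cstP x : ev lamE dif (cstP x) = j x.
Proof. by rewrite /cstP /= evC /= lamE_cst. Qed.

Lemma ev_at1 h : ev lamE dif (at1 h) = ev j t h.
Proof.
by rewrite /at1 map_ev /= ev_pt1; apply: eq_ev => x; apply: ev_cstP.
Qed.

Lemma ev_at2 h : ev lamE dif (at2 h) = ev j t' h.
Proof.
by rewrite /at2 map_ev /= ev_pt2; apply: eq_ev => x; apply: ev_cstP.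
Qed.

Lemma ev_chord0 : ev lamE dif (chord0 h1 h2) = minor t t'.
Proof. by rewrite /chord0 rmorph_minor /= !ev_at1 !ev_at2. Qed.

Lemma ev_chord1 : ev lamE dif (chord1 h0 h2) = a * minor t t'.
Proof.
have [it it' _] := dr; have [e _] := perp_cross it it'.
by rewrite /chord1 rmorph_minor /= !ev_at1 !ev_at2.
Qed.

Lemma ev_chord2 : ev lamE dif (chord2 h0 h1) = b * minor t t'.
Proof.
have [it it' _] := dr; have [_ e] := perp_cross it it'.
by rewrite /chord2 rmorph_minor /= !ev_at1 !ev_at2.
Qed.

Lemma lam_coefQ1 : lam (coefQ1 h0 h1 h2) = a.
Proof.
by rewrite /coefQ1 fmorph_div /= !lam_tofrac ev_chord0 ev_chord1 mulfK ?pair_minor_neq0.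
Qed.

Lemma lam_coefQ2 : lam (coefQ2 h0 h1 h2) = b.
Proof.
by rewrite /coefQ2 fmorph_div /= !lam_tofrac ev_chord0 ev_chord2 mulfK ?pair_minor_neq0.
Qed.

Lemma lam_cstQ x : lam (cstQ x) = j x.
Proof. by rewrite /cstQ /= lam_tofrac ev_cstP. Qed.

(** The rational functions that express the base field in terms of a pair of roots
    are the same for all pairs. *)
Lemma lam_ab P :
  lam (ev (ev (@cstQ R) (coefQ1 h0 h1 h2)) (coefQ2 h0 h1 h2) P) = ev (ev j a) b P.
Proof.
rewrite map_ev /= lam_coefQ2; apply: eq_ev => q /=.
rewrite map_ev /= lam_coefQ1; apply: eq_ev => x /=; exact: lam_cstQ.
Qed.

End Pair.
End Roots.

(** * Double transitivity *)

Section Galois.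
Variables (R : idomainType) (K : fieldType) (phi : {rmorphism R -> K}).
Hypothesis phi_inj : injective phi.
Variables (a b : K) (h0 h1 h2 : {poly R}).
Hypothesis ab_indep : indep2 phi a b.
Hypothesis ab_gen : forall x, exists P Q : {poly {poly R}},
  x = ev (ev phi a) b P / ev (ev phi a) b Q.
Hypothesis wr_neq0 : wr h0 h1 h2 != 0.
Hypothesis sep : separates_generic [:: h0; h1; h2].
Hypothesis ncr : no_common_root [:: h0; h1; h2].
Hypothesis two_neq0 : 2%:R != 0 :> R.
Variable L : splittingFieldType K.

Definition comb : {poly K} := map_poly phi h0 + a *: map_poly phi h1 + b *: map_poly phi h2.

Definition base : R -> L := in_alg L \o phi.
HB.instance Definition _ := GRing.RMorphism.copy base (in_alg L \o phi).

Local Notation j := base.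
Local Notation A := (in_alg L a).
Local Notation B := (in_alg L b).

Lemma base_inj : injective j.
Proof. by move=> x y /fmorph_inj/phi_inj. Qed.

Lemma two_neq0L : 2%:R != 0 :> L.
Proof. by rewrite -(rmorph_nat j) (inj_rmorph_eq0 base_inj). Qed.

Lemma ev_base1 (p : {poly R}) x : in_alg L (ev phi x p) = ev j (in_alg L x) p.
Proof. by rewrite map_ev; apply: eq_ev. Qed.

Lemma ev_base2 (P : {poly {poly R}}) :
  in_alg L (ev (ev phi a) b P) = ev (ev j A) B P.
Proof. by rewrite map_ev; apply: eq_ev => q; apply: ev_base1. Qed.

Lemma ab_indepL : indep2 j A B.
Proof.
have [ta tb] := ab_indep; split=> [] [P P0 e].
  by apply: ta; exists P => //; move/eqP: e; rewrite -ev_base1 fmorph_eq0 => /eqP.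
by apply: tb; exists P => //; move/eqP: e; rewrite -ev_base2 fmorph_eq0 => /eqP.
Qed.

Local Notation incidentL := (incident j A B h0 h1 h2).

Lemma horner_comb r :
  (map_poly (in_alg L) comb).[r] = ev j r h0 + A * ev j r h1 + B * ev j r h2.
Proof.
rewrite /comb !rmorphD /= !map_polyZ /= !hornerD !hornerZ !evE.
by rewrite -!(map_poly_comp (in_alg L) phi).
Qed.

Lemma root_combP r : root (map_poly (in_alg L) comb) r <-> incidentL r.
Proof. by rewrite /root horner_comb; split=> [/eqP|->]. Qed.

Lemma deriv_comb_neq0 r : incidentL r -> (map_poly (in_alg L) comb)^`().[r] != 0.
Proof.
move=> ir; rewrite deriv_map /comb !derivD !derivZ !deriv_map.
apply/eqP; rewrite !rmorphD /= !map_polyZ /= !hornerD !hornerZ.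
rewrite -!(map_poly_comp (in_alg L) phi) -!(evE j).
exact: (incident_simple base_inj ab_indepL wr_neq0 ncr).
Qed.

Lemma gal_base (g : gal_of {:L}) x : g (j x) = j x.
Proof. by rewrite /base /= linearZ /= rmorph1. Qed.

Lemma gal_in_alg (g : gal_of {:L}) (x : K) : g (in_alg L x) = in_alg L x.
Proof. by rewrite /= linearZ /= rmorph1. Qed.

Lemma gal_ev (g : gal_of {:L}) r h : g (ev j r h) = ev j (g r) h.
Proof. by rewrite map_ev; apply: eq_ev => x; apply: gal_base. Qed.

Lemma gal_incident (g : gal_of {:L}) r : incidentL r -> incidentL (g r).
Proof.
move=> e; rewrite /incident -!gal_ev -(gal_in_alg g a) -(gal_in_alg g b).
by rewrite -!rmorphM -!rmorphD e rmorph0.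
Qed.

Local Notation good := (distinct_roots j A B h0 h1 h2).
Local Notation lamL d := (@lam R L j base_inj A B h0 h1 h2 ab_indepL sep ncr two_neq0L _ _ d).

Section Conjugation.
Variables t1 t2 u1 u2 : L.
Hypotheses (dt : good t1 t2) (du : good u1 u2).

(** [x] is given by the same rational function of both pairs; for every element of
    the base field this is so, and it is all that conjugacy requires. *)
Definition same_value x := exists q, lamL dt q = x /\ lamL du q = x.

Lemma same_value_base x : x \in 1%VS -> same_value x.
Proof.
case/vlineP => k ->; have [P [Q ->]] := ab_gen k.
pose e := ev (ev (@cstQ R) (coefQ1 h0 h1 h2)) (coefQ2 h0 h1 h2).
exists (e P / e Q); rewrite !fmorph_div /e /= !lam_ab -!ev_base2 -fmorph_div.
by [].
Qed.

Lemma same_value_polyOver (M : {subfield L}) (p : {poly L}) :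
    (forall x, x \in M -> same_value x) -> p \is a polyOver M ->
  exists q, map_poly (lamL dt) q = p /\ map_poly (lamL du) q = p.
Proof.
move=> sM; elim/poly_ind: p => [|p c IHp] Mp.
  by exists 0; rewrite !rmorph0.
have Mc : c \in M.
  by have /polyOverP/(_ 0) := Mp; rewrite coefD coefMX coefC add0r.
have {}Mp : p \is a polyOver M.
  apply/polyOverP => i; have /polyOverP/(_ i.+1) := Mp.
  by rewrite coefD coefMX coefC addr0.
have [q [q1 q2]] := IHp Mp; have [d [d1 d2]] := sM c Mc.
exists (q * 'X + d%:P).
by rewrite !rmorphD !rmorphM /= !map_polyX !map_polyC /= q1 q2 d1 d2.
Qed.

Lemma minPoly_conj (M : {subfield L}) T :
    (forall x, x \in M -> same_value x) ->
  root (minPoly M (lamL dt T)) (lamL du T).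
Proof.
move=> sM; have [q [q1 q2]] := same_value_polyOver sM (minPolyOver M (lamL dt T)).
have : root (minPoly M (lamL dt T)) (lamL dt T) by apply: root_minPoly.
rewrite -{1}q1 /root horner_map fmorph_eq0 => /eqP qT.
by rewrite -q2 horner_map qT rmorph0.
Qed.

End Conjugation.

Lemma lam_pt1 t1 t2 (d : good t1 t2) : lamL d (tofrac (pt1 R)) = t1.
Proof. by rewrite lam_tofrac ev_pt1. Qed.

Lemma lam_pt2 t1 t2 (d : good t1 t2) : lamL d (tofrac (pt2 R)) = t2.
Proof. by rewrite lam_tofrac ev_pt2. Qed.

(** First move [t1] to [u1], since their minimal polynomials agree; then, over the
    field generated by [u1], move the image of [t2] to [u2]. *)
Lemma roots_2transitive t1 t2 u1 u2 : good t1 t2 -> good u1 u2 ->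
  exists2 g, g \in 'Gal({:L} / 1)%g & g t1 = u1 /\ g t2 = u2.
Proof.
move=> dt du.
have [|g1 Gg1 g1E] := normalField_root_minPoly (sub1v _) (normalFieldf 1) (memvf t1) (b := u1).
  rewrite -{1}(lam_pt1 dt) -{1}(lam_pt1 du); apply: minPoly_conj.
  exact: same_value_base.
have dg : good u1 (g1 t2).
  have [it1 it2 ne] := dt; have [iu1 _ _] := du; split=> //.
    exact: gal_incident.
  by rewrite -g1E (inj_eq (fmorph_inj _)).
have [|g2 Gg2 g2E] := normalField_root_minPoly (subvf <<1; u1>>%AS)
    (normalFieldf _) (memvf (g1 t2)) (b := u2).
  rewrite -{1}(lam_pt2 dg) -{1}(lam_pt2 du); apply: minPoly_conj.
  move=> x /Fadjoin_polyP[p p1 ->].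
  have [q [q1 q2]] := same_value_polyOver (same_value_base dg du) p1.
  exists q.[tofrac (pt1 R)].
  by rewrite -!horner_map q1 q2 /= !lam_pt1.
exists (g1 * g2)%g.
  by rewrite groupM // (subsetP (galS _ _) _ Gg2) // sub1v.
rewrite !galM ?memvf // g1E g2E; split=> //.
by rewrite (fixed_gal (subvf _) Gg2) // memv_adjoin.
Qed.

End Galois.

Lemma loc_int_add_eq (R : comNzRingType) (p q x y : R) :
  p * q * (x + y) = q * (p * x) + p * (q * y).
Proof. by ring. Qed.
Lemma loc_int_mul_eq (R : comNzRingType) (p q x y : R) :
  p * q * (x * y) = (p * x) * (q * y).
Proof. by ring. Qed.
Lemma loc_int_root_eq (R : comNzRingType) (p l1 l2 x : R) :
  p * l1 * (l2 * x) = l1 * l2 * (p * x).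
Proof. by ring. Qed.
Lemma loc_int_frac_eq (R : comNzRingType) (c q1 q2 x : R) :
  c * (q2 * x) * q1 = q1 * q2 * (c * x).
Proof. by ring. Qed.

(** * Integrality over a localized polynomial ring *)

Section LocalIntegral.
Variables (E F : fieldType) (g : {rmorphism {poly E} -> F}).
Hypothesis ginj : injective g.

(** Integrality over the local ring of [E[u]] at [u = 0]. *)
Definition loc_int x := exists2 q : {poly E}, q.[0] != 0 & integralOver g (g q * x).

Lemma loc_int_base p : loc_int (g p).
Proof.
exists 1; first by rewrite hornerC oner_eq0.
by rewrite rmorph1 mul1r; apply: integral_id.
Qed.

Lemma lint0 : loc_int 0. Proof. by rewrite -(rmorph0 g); apply: loc_int_base. Qed.
Lemma lint1 : loc_int 1. Proof. by rewrite -(rmorph1 g); apply: loc_int_base. Qed.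

Lemma loc_int_add x y : loc_int x -> loc_int y -> loc_int (x + y).
Proof.
case=> p p0 ix [q q0 iy]; exists (p * q); first by rewrite hornerM mulf_neq0.
rewrite rmorphM /= loc_int_add_eq.
by apply: integral_add; apply: integral_mul => //; apply: integral_id.
Qed.

Lemma loc_int_mul x y : loc_int x -> loc_int y -> loc_int (x * y).
Proof.
case=> p p0 ix [q q0 iy]; exists (p * q); first by rewrite hornerM mulf_neq0.
by rewrite rmorphM /= loc_int_mul_eq; apply: integral_mul.
Qed.

Lemma loc_int_opp x : loc_int x -> loc_int (- x).
Proof.
by move=> ix; rewrite -mulN1r -(rmorphN1 g); apply: loc_int_mul ix; apply: loc_int_base.
Qed.

Lemma loc_int_sum (I : Type) (s : seq I) (P : pred I) (f : I -> F) :
  (forall i, P i -> loc_int (f i)) -> loc_int (\sum_(i <- s | P i) f i).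
Proof. by move=> h; apply: big_ind => //; [exact: lint0 | exact: loc_int_add]. Qed.

Lemma loc_int_exp x n : loc_int x -> loc_int (x ^+ n).
Proof.
move=> ix; elim: n => [|n IHn]; first by rewrite expr0; exact: lint1.
by rewrite exprS; apply: loc_int_mul.
Qed.

Lemma loc_int_ev (P : {poly {poly E}}) x : loc_int x -> loc_int (ev g x P).
Proof.
move=> ix; rewrite evE horner_coef; apply: loc_int_sum => i _.
by rewrite coef_map; apply: loc_int_mul; [exact: loc_int_base | exact: loc_int_exp].
Qed.

(** Multiplying a root by the leading coefficient makes it integral. *)
Lemma loc_int_root (P : {poly {poly E}}) x :
  (lead_coef P).[0] != 0 -> ev g x P = 0 -> loc_int x.
Proof.
set l := lead_coef P => l0 Px; exists l => //.
have lN0 : l != 0 by apply: contraNneq l0 => ->; rewrite horner0.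
have P0 : P != 0 by rewrite -lead_coef_eq0.
case sP : (size P) => [|[|n]].
- by move/eqP: sP; rewrite size_poly_eq0 (negPf P0).
- have /size_poly1P[c c0 PE] : size P == 1 by rewrite sP.
  move: Px; rewrite PE evC => /eqP; rewrite (inj_rmorph_eq0 ginj).
  by rewrite (negPf c0).
(* The equation of [l x], for [l] the leading coefficient of [P]. *)
pose Q := 'X^(n.+1) + \poly_(i < n.+1) (P`_i * l ^+ (n - i)).
have lPn : P`_n.+1 = l by rewrite /l lead_coefE sP.
exists Q.
  rewrite monicE lead_coefDl ?lead_coefXn // size_polyXn ltnS; exact: size_poly.
apply/rootP; rewrite -evE /Q rmorphD rmorphXn /= evX.
have -> : ev g (g l * x) (\poly_(i < n.+1) (P`_i * l ^+ (n - i))) =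
    g l ^+ n * (\sum_(i < n.+1) g P`_i * x ^+ i).
  rewrite poly_def rmorph_sum mulr_sumr; apply: eq_bigr => i _ /=.
  rewrite -mul_polyC rmorphM rmorphXn /= evC evX rmorphM rmorphXn /= exprMn.
  by rewrite loc_int_root_eq -exprD subnK // -ltnS ltn_ord.
rewrite exprMn exprSr -mulrA -mulrDr.
apply/eqP; rewrite mulf_eq0 expf_eq0 (inj_rmorph_eq0 ginj) (negPf lN0) andbF /=.
move: Px; rewrite evE (@horner_coef_wide _ n.+2); last by rewrite -sP size_poly.
rewrite big_ord_recr /= coef_map /= lPn => Px.
rewrite addrC; apply/eqP; rewrite -[RHS]Px; congr (_ + _).
by apply: eq_bigr => i _; rewrite coef_map.
Qed.

(** The local ring at [u = 0] is integrally closed: if the denominator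
    [q] vanished at 0, the homogenized integral equation, taken at 0, would make
    the numerator vanish there too. *)
Lemma loc_int_frac x p q : q != 0 -> p.[0] != 0 \/ q.[0] != 0 ->
  x = g p / g q -> loc_int x -> q.[0] != 0.
Proof.
move=> qN0 [p0|//] xE [q0 q00 [c cmon cx]]; apply/negP => /eqP qz.
have gq : g q != 0 by rewrite (inj_rmorph_eq0 ginj).
pose n := (size c).-1; have sc : size c = n.+1.
  by rewrite /n prednK // lt0n size_poly_eq0 monic_neq0.
(* The integral equation of [q0 x], multiplied by the power [n] of [q]. *)
pose S := \sum_(i < n.+1) c`_i * (q0 * p) ^+ i * q ^+ (n - i).
have S0 : S = 0.
  apply: ginj; rewrite rmorph0.
  have <- : g q ^+ n * (map_poly g c).[g q0 * x] = 0 by rewrite (rootP cx) mulr0.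
  rewrite (@horner_coef_wide _ n.+1) -?sc ?size_poly // mulr_sumr rmorph_sum sc.
  apply: eq_bigr => i _; rewrite !rmorphM !rmorphXn rmorphM coef_map /= xE.
  have -> : g q ^+ n = g q ^+ (n - i) * g q ^+ i.
    by rewrite -exprD subnK // -ltnS ltn_ord.
  rewrite -loc_int_frac_eq -exprMn; congr (_ * _ ^+ _ * _).
  by rewrite mulrA [g q * _]mulrC divfK.
have := congr1 (horner_eval 0) S0; rewrite /horner_eval horner0 /S horner_sum.
rewrite big_ord_recr /= big1 => [|i _]; last first.
  by rewrite !hornerE qz expr0n subn_eq0 leqNgt ltn_ord mulr0.
have cn : c`_n = 1 by have := monicP cmon; rewrite lead_coefE sc.
rewrite cn mul1r subnn expr0 mulr1 add0r horner_exp hornerM => /eqP.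
by rewrite expf_eq0 mulf_eq0 (negPf q00) (negPf p0) andbF.
Qed.

Lemma loc_int_invX : ~ loc_int (g 'X)^-1.
Proof.
have e : (g 'X)^-1 = g 1 / g 'X by rewrite rmorph1 div1r.
have X0 : 'X != 0 :> {poly E} by rewrite polyX_eq0.
move=> /(loc_int_frac X0 _ e) h; have : (1 : {poly E}).[0] != 0 \/ ('X : {poly E}).[0] != 0.
  by left; rewrite hornerC oner_eq0.
by move/h; rewrite hornerX eqxx.
Qed.

Lemma frac_normal p q : q != 0 -> exists p' q' : {poly E},
  [/\ q' != 0, g p / g q = g p' / g q' & p'.[0] != 0 \/ q'.[0] != 0].
Proof.
move=> q0; pose d := gcdp p q.
have dN0 : d != 0 by rewrite gcdp_eq0 negb_and q0 orbT.
have pE : p %/ d * d = p by rewrite divpK // dvdp_gcdl.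
have qE : q %/ d * d = q by rewrite divpK // dvdp_gcdr.
exists (p %/ d), (q %/ d).
have q'0 : q %/ d != 0 by apply: contraNneq q0 => e; rewrite -qE e mul0r.
split=> //.
  rewrite -{1}pE -{1}qE !rmorphM /= -mulf_div divff ?mulr1 //.
  by rewrite (inj_rmorph_eq0 ginj).
have cop : coprimep (p %/ d) (q %/ d) by apply: coprimep_div_gcd; rewrite q0 orbT.
have [p0|p0] := eqVneq (p %/ d).[0] 0; [right | by left].
by apply: (coprimep_root cop); apply/rootP.
Qed.

End LocalIntegral.

(** * Inertia *)

Lemma one_add_mul_eq (R : comNzRingType) (u x y : R) :
  (1 + u * x) * (1 + u * y) = 1 + u * (x + y + u * (x * y)).
Proof. by ring. Qed.

Lemma dual_family_eq (R : comNzRingType) (e r r' x y : R) :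
  - (e * r') * x * y + e * x * (r * y) = (r - r') * e * (x * y).
Proof. by ring. Qed.

Section Inertia.
Variables (E K : fieldType) (L : splittingFieldType K).
Variables (g : {rmorphism {poly E} -> L}) (Gam : {group gal_of {:L}}).
Hypothesis ginj : injective g.
Local Notation u := (g 'X).
Local Notation loc_int := (loc_int g).

Variable other : L -> Prop.
Hypothesis loc_int_other : forall r, other r -> loc_int r.
Hypothesis gal_other : forall (s : gal_of {:L}) r, s \in Gam -> other r -> other (s r).
Hypothesis other_separated : forall r r', other r -> other r' -> r != r' ->
  exists e z, [/\ loc_int e, loc_int z & (r - r') * e = 1 + u * z].

(** A dual family for the trace form: unramifiedness makes the orthogonality
    relations solvable with coefficients that are integral at [u = 0]. *)
Lemma dual_family (ss : seq (gal_of {:L})) :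
    (forall s, s \in ss -> s \in Gam /\ exists2 r, other r & s r != r) ->
  exists l : seq (L * L),
    [/\ forall c, c \in l -> loc_int c.1 /\ forall s, s \in Gam -> loc_int (s c.2),
        forall s, s \in ss -> \sum_(c <- l) c.1 * s c.2 = 0
      & exists2 z, loc_int z & \sum_(c <- l) c.1 * c.2 = 1 + u * z].
Proof.
elim: ss => [|s0 ss IHss] hss.
  exists [:: (1, 1)]; split=> //.
    move=> c; rewrite inE => /eqP-> /=; split=> [|s _]; first exact: lint1.
    by rewrite rmorph1; exact: lint1.
  by exists 0; [exact: lint0 | rewrite big_seq1 !mulr1 mulr0 addr0].
have [|l [lin lz [z iz lE]]] := IHss.
  by move=> s sss; apply: hss; rewrite inE sss orbT.
have [Gs0 [r or sr]] := hss s0 (mem_head _ _).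
have [|e [y [ie iy eE]]] := other_separated or (gal_other Gs0 or).
  by rewrite eq_sym.
(* The factor [(s r - s0 r) e] creates the relation for [s0] without spoiling the
   earlier ones; at [s = 1] it is congruent to 1 modulo [u]. *)
pose l1 := [seq (- (e * s0 r) * c.1, c.2) | c <- l].
pose l2 := [seq (e * c.1, r * c.2) | c <- l].
have sumE (s : {rmorphism L -> L}) : \sum_(c <- l1 ++ l2) c.1 * s c.2 =
    (s r - s0 r) * e * \sum_(c <- l) c.1 * s c.2.
  rewrite big_cat !big_map /= -big_split mulr_sumr; apply: eq_bigr => c _ /=.
  by rewrite rmorphM; exact: dual_family_eq.
exists (l1 ++ l2); split.
- move=> c; rewrite mem_cat => /orP[] /mapP[d /lin[i1 i2] ->] /=; split=> //.
  + apply: loc_int_mul => //; apply: loc_int_opp; apply: loc_int_mul => //.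
    exact/loc_int_other/gal_other.
  + exact: loc_int_mul.
  move=> s Gs; rewrite rmorphM; apply: loc_int_mul; last exact: i2.
  exact/loc_int_other/gal_other.
- move=> s; rewrite inE => /predU1P[->|sss]; first by rewrite sumE subrr !mul0r.
  by rewrite sumE lz ?mulr0.
exists (y + z + u * (y * z)).
  apply: loc_int_add; first exact: loc_int_add.
  by apply: loc_int_mul; [exact: loc_int_base | exact: loc_int_mul].
by have /= -> := sumE idfun; rewrite eE lE one_add_mul_eq.
Qed.

Hypothesis fixed_frac : forall x, (forall s, s \in Gam -> s x = x) ->
  exists p q, q != 0 /\ x = g p / g q.
Hypothesis gal_u : forall s, s \in Gam -> s u = u \/ s u = - u.
Variable tau : gal_of {:L}.
Hypothesis Gtau : tau \in Gam.
Hypothesis tauE : forall p, tau (g p) = g (p \Po (- 'X)).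
Hypothesis two_neq0 : 2%:R != 0 :> E.

Lemma u_neq0 : u != 0.
Proof. by rewrite (inj_rmorph_eq0 ginj) polyX_eq0. Qed.

(** This sum is antisymmetric under [u |-> - u]; being a rational function of [u]
    that is integral at 0, it is divisible by [u], as 2 is invertible. *)
Lemma antisym_trace b : (forall s, s \in Gam -> loc_int (s b)) ->
  exists2 z, loc_int z & \sum_(s in Gam) s u / u * s b = u * z.
Proof.
move=> ib; set c := \sum_(s in Gam) _.
have uc : u * c = \sum_(s in Gam) s (u * b).
  rewrite mulr_sumr; apply: eq_bigr => s _.
  by rewrite mulrA [u * _]mulrC divfK ?u_neq0 // rmorphM.
have ic : loc_int c.
  apply: loc_int_sum => s Gs; apply: loc_int_mul; last exact: ib.
  have [->|->] := gal_u Gs; last rewrite mulNr; rewrite divff ?u_neq0 //.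
    exact: lint1.
  by apply: loc_int_opp => //; apply: lint1.
have fix_uc s : s \in Gam -> s (u * c) = u * c.
  move=> Gs; rewrite uc rmorph_sum [RHS](reindex_inj (mulIg s)) /=.
  apply: eq_big => [x|x _]; first by rewrite groupMr.
  by rewrite galM ?memvf.
have [p0 [q0 [q0N0 ucE]]] := fixed_frac fix_uc.
have [p [q [qN0 cE pq0]]] := frac_normal ginj p0 (mulf_neq0 q0N0 (negbT (polyX_eq0 E))).
have {}cE : c = g p / g q.
  rewrite -cE rmorphM invfM mulrA -ucE [u * c]mulrC mulfK ?u_neq0 //.
have q00 := loc_int_frac ginj qN0 pq0 cE ic.
have tauu : tau u = - u by rewrite tauE comp_polyX rmorphN.
have tauc : tau c = - c.
  have := fix_uc _ Gtau; rewrite rmorphM /= tauu mulNr => e.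
  by apply: (mulfI u_neq0); rewrite mulrN -e opprK.
have gq : g q != 0 by rewrite (inj_rmorph_eq0 ginj).
have : g ((p \Po (- 'X)) * q) = g (- p * (q \Po (- 'X))).
  have gq' : g (q \Po (- 'X)) != 0 by rewrite -tauE fmorph_eq0.
  by apply/eqP; rewrite !rmorphM rmorphN -eqr_div // -!tauE -fmorph_div -cE /= tauc cE mulNr.
move=> /ginj/(congr1 (horner_eval 0)).
rewrite /horner_eval !hornerM !horner_comp hornerN !hornerE oppr0 => e.
have {e} : p.[0] * q.[0] * 2%:R = 0.
  by rewrite mulr_natr mulr2n {1}e mulNr addNr.
move/eqP; rewrite !mulf_eq0 (negPf q00) (negPf two_neq0) !orbF => p00.
have /factor_theorem[p1 pE] : root p 0 by [].
exists (g p1 / g q); last first.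
  by rewrite cE pE polyC0 subr0 rmorphM [_ * u]mulrC mulrA.
exists q => //; rewrite mulrC divfK //; exact: integral_id.
Qed.

(** The inertia group at [u = 0] of the extension generated by the other roots
    would be trivial if these roots distinguished the elements of [Gam]; then
    [u], which is a uniformizer upstairs, would be a unit. *)
Lemma inertia_nontrivial :
  ~ (forall s, s \in Gam -> s != 1%g -> exists2 r, other r & s r != r).
Proof.
move=> moved.
have [|l [lin lz [z iz lE]]] := @dual_family (enum (Gam :\ 1%g)).
  move=> s; rewrite mem_enum in_setD1 => /andP[s1 Gs]; split=> //; exact: moved.
(* The same sum computed in two ways: by the duality relations, and by
   antisymmetry. *)
have e1 : \sum_(s in Gam) s u / u * (\sum_(c <- l) c.1 * s c.2) = 1 + u * z.
  rewrite (bigD1 1%g) ?group1 //= [X in _ + X]big1 => [|s /andP[Gs s1]]; last first.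
    by rewrite lz ?mulr0 // mem_enum in_setD1 s1.
  rewrite addr0 gal_id divff ?u_neq0 // mul1r -lE.
  by apply: eq_bigr => c _; rewrite gal_id.
have [z' iz' e2] : exists2 z', loc_int z' &
    \sum_(s in Gam) s u / u * (\sum_(c <- l) c.1 * s c.2) = u * z'.
  have -> : \sum_(s in Gam) s u / u * (\sum_(c <- l) c.1 * s c.2) =
      \sum_(c <- l) c.1 * (\sum_(s in Gam) s u / u * s c.2).
    under eq_bigr do rewrite mulr_sumr.
    rewrite exchange_big; apply: eq_bigr => c _; rewrite mulr_sumr.
    by apply: eq_bigr => s _; rewrite mulrCA.
  elim: (l) lin => [|c l' IHl] lin.
    by exists 0; [exact: lint0 | rewrite big_nil mulr0].
  have [|z1 iz1 E1] := IHl; first by move=> d dl; apply: lin; rewrite inE dl orbT.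
  have [i1 i2] := lin c (mem_head _ _); have [z2 iz2 E2] := antisym_trace i2.
  exists (c.1 * z2 + z1); first by apply: loc_int_add => //; apply: loc_int_mul.
  by rewrite big_cons E1 E2 mulrDr mulrCA.
apply: (loc_int_invX ginj).
have -> : u^-1 = z' - z.
  apply: (mulfI u_neq0); rewrite divff ?u_neq0 // mulrBr -e2 e1 addrK //.
by apply: loc_int_add => //; apply: loc_int_opp.
Qed.

End Inertia.

(** * The residual polynomial of a chord *)

Lemma minor_repeated (S : comNzRingType) (x0 x1 x2 y0 y1 y2 : S) :
  ((x1 * y2 - x2 * y1) * x0 + (x2 * y0 - x0 * y2) * x1 + (x0 * y1 - x1 * y0) * x2 = 0)
  * ((x1 * y2 - x2 * y1) * y0 + (x2 * y0 - x0 * y2) * y1 + (x0 * y1 - x1 * y0) * y2 = 0).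
Proof. by split; ring. Qed.

Lemma deriv_minor (S : comNzRingType) (p q r s : {poly S}) x a b c d a' b' c' d' :
    p.[x] = a -> q.[x] = b -> r.[x] = c -> s.[x] = d ->
    p^`().[x] = a' -> q^`().[x] = b' -> r^`().[x] = c' -> s^`().[x] = d' ->
  (p * q - r * s)^`().[x] = a' * b + a * b' - (c' * d + c * d').
Proof.
by move=> <- <- <- <- <- <- <- <-; rewrite derivB !derivM !hornerE.
Qed.

Lemma chord_limit_eq (S : comNzRingType) (x y x' y' : S) :
  x' * y + x * - y' - (y' * x + y * - x') = - 2%:R * (x * y' - y * x').
Proof. by ring. Qed.

Lemma coef_map_lin3 (R S : comNzRingType) (g : {rmorphism R -> S})
    (p0 p1 p2 : S) (q0 q1 q2 : {poly R}) i :
  (p0 *: map_poly g q0 + p1 *: map_poly g q1 + p2 *: map_poly g q2)`_i =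
  p0 * g q0`_i + p1 * g q1`_i + p2 * g q2`_i.
Proof. by rewrite !coefD !coefZ !coef_map. Qed.

Lemma reduced_minor_root (S : idomainType) (X c0 c1 c2 x0 x1 x2 y0 y1 y2 : S) :
    X != 0 -> x1 * y2 - x2 * y1 = X * c0 -> x2 * y0 - x0 * y2 = X * c1 ->
    x0 * y1 - x1 * y0 = X * c2 ->
  (c0 * x0 + c1 * x1 + c2 * x2 = 0) * (c0 * y0 + c1 * y1 + c2 * y2 = 0).
Proof.
move=> X0 e0 e1 e2; have [ex ey] := minor_repeated x0 x1 x2 y0 y1 y2.
by split; apply: (mulfI X0); rewrite mulr0 !mulrDr !mulrA -e0 -e1 -e2.
Qed.

Lemma horner_map_lin3 (R S : comNzRingType) (g : {rmorphism R -> S})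
    (p0 p1 p2 x : S) (q0 q1 q2 : {poly R}) :
  (p0 *: map_poly g q0 + p1 *: map_poly g q1 + p2 *: map_poly g q2).[x] =
  p0 * ev g x q0 + p1 * ev g x q1 + p2 * ev g x q2.
Proof. by rewrite !hornerD !hornerZ !evE. Qed.

Lemma factor_two_roots (S : idomainType) (P : {poly S}) x y :
  P.[x] = 0 -> P.[y] = 0 -> y - x != 0 ->
  exists H, P = H * ('X - x%:P) * ('X - y%:P).
Proof.
move=> Px Py xy; have /factor_theorem[Q QE] : root P x by apply/rootP.
have /factor_theorem[H HE] : root Q y.
  by move: Py; rewrite QE hornerM !hornerE => /eqP; rewrite mulf_eq0 (negPf xy) orbF.
by exists H; rewrite QE HE mulrAC.
Qed.

Lemma sub_add_polyX_neq0 (S : idomainType) (c : S) : 2%:R != 0 :> S ->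
  (c%:P - 'X) - (c%:P + 'X) != 0.
Proof.
move=> two; rewrite opprD addrACA subrr add0r -opprD oppr_eq0 -mulr2n.
by rewrite -mulr_natl -polyC_natr mulf_eq0 polyC_eq0 negb_or two polyX_eq0.
Qed.

Lemma scale_square_factor (F : fieldType) (k s : F) (H T : {poly F}) : k != 0 ->
  H * ('X - s%:P) * ('X - s%:P) = k *: T -> ('X - s%:P) ^+ 2 * (k^-1 *: H) = T.
Proof.
by move=> k0 e; rewrite -scalerAr expr2 mulrC mulrA e scalerA mulVf // scale1r.
Qed.

Lemma coprimep_unscale (F : fieldType) (k : F) (H : {poly F}) :
  coprimep (k *: H) (k *: H)^`() -> coprimep H H^`().
Proof.
have [->|k0] := eqVneq k 0; first by rewrite scale0r coprime0p deriv0 eqp01.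
by rewrite derivZ coprimepZl // coprimepZr.
Qed.

Lemma lead_coef_two_roots (S : idomainType) (H : {poly S}) x y :
  lead_coef (H * ('X - x%:P) * ('X - y%:P)) = lead_coef H.
Proof. by rewrite !lead_coef_Mmonic ?monicXsubC. Qed.

Lemma lin3_const (S : idomainType) (p0 p1 p2 : {poly S}) (c0 c1 c2 : S) :
  - 2%:R * @tofrac _ p0 * cst c0 + - 2%:R * @tofrac _ p1 * cst c1 + - 2%:R * @tofrac _ p2 * cst c2
  = - 2%:R * @tofrac _ (p0 * c0%:P + p1 * c1%:P + p2 * c2%:P).
Proof. by rewrite !rmorphD !rmorphM /= !mulrDr !mulrA. Qed.

Lemma scale_lin3 (S : comNzRingType) (k p0 p1 p2 : S) (q0 q1 q2 : {poly S}) :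
  (k * p0) *: q0 + (k * p1) *: q1 + (k * p2) *: q2 =
  k *: (p0 *: q0 + p1 *: q1 + p2 *: q2).
Proof. by rewrite !scalerDr !scalerA. Qed.

Lemma eq_lin3 (S : nzRingType) (p0 p1 p2 p0' p1' p2' : S) (q0 q1 q2 q0' q1' q2' : {poly S}) :
  p0 = p0' -> p1 = p1' -> p2 = p2' -> q0 = q0' -> q1 = q1' -> q2 = q2' ->
  p0 *: q0 + p1 *: q1 + p2 *: q2 = p0' *: q0' + p1' *: q1' + p2' *: q2'.
Proof. by do 6 move=> ->. Qed.

Lemma horner_lin3_cst (F : comNzRingType) (p0 p1 p2 : {poly F}) (k0 k1 k2 c0 c1 c2 : F) :
  p0.[0] = k0 -> p1.[0] = k1 -> p2.[0] = k2 ->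
  (p0 * c0%:P + p1 * c1%:P + p2 * c2%:P).[0] = k0 * c0 + k1 * c1 + k2 * c2.
Proof. by move=> <- <- <-; rewrite !hornerD !hornerM !hornerC. Qed.

Section Chord.
Variables (R : idomainType) (h0 h1 h2 : {poly R}).
Hypothesis wr_neq0 : wr h0 h1 h2 != 0.
Hypothesis sep : separates_generic [:: h0; h1; h2].
Hypothesis two_neq0 : 2%:R != 0 :> R.
Local Notation E := {fraction {poly R}}.

Lemma tofrac_horner (h : {poly R}) : (map_poly (@cst R) h).[gen R] = tofrac h.
Proof.
rewrite -(evE (@cst R)); have /= := @ev_gen R E idfun h => <-.
by apply: eq_ev.
Qed.

Lemma at1E (h : {poly R}) : at1 h = map_poly (@cst R) h \Po ((gen R)%:P + 'X).
Proof. by rewrite /at1 evE /pt1 -lock map_poly_comp /comp_poly. Qed.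

Lemma at2E (h : {poly R}) : at2 h = map_poly (@cst R) h \Po ((gen R)%:P - 'X).
Proof. by rewrite /at2 evE /pt2 -lock map_poly_comp /comp_poly. Qed.

Lemma at1_0 (h : {poly R}) : (at1 h).[0] = tofrac h.
Proof. by rewrite at1E horner_comp hornerD hornerC hornerX addr0 tofrac_horner. Qed.

Lemma at2_0 (h : {poly R}) : (at2 h).[0] = tofrac h.
Proof. by rewrite at2E horner_comp hornerD hornerN hornerC hornerX subr0 tofrac_horner. Qed.

Lemma deriv_at1_0 (h : {poly R}) : (at1 h)^`().[0] = tofrac h^`().
Proof.
rewrite at1E deriv_comp hornerM horner_comp hornerD hornerC hornerX addr0.
by rewrite derivD derivC derivX add0r hornerC mulr1 deriv_map tofrac_horner.
Qed.

Lemma deriv_at2_0 (h : {poly R}) : (at2 h)^`().[0] = - tofrac h^`().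
Proof.
rewrite at2E deriv_comp hornerM horner_comp hornerD hornerN hornerC hornerX subr0.
by rewrite derivB derivC derivX sub0r hornerN hornerC mulrN1 deriv_map tofrac_horner.
Qed.

Lemma minor_at_0 (p q : {poly R}) : (at1 p * at2 q - at1 q * at2 p).[0] = 0.
Proof. by rewrite hornerD hornerN !hornerM !at1_0 !at2_0 mulrC subrr. Qed.

Lemma deriv_minor_at_0 (p q : {poly R}) : (at1 p * at2 q - at1 q * at2 p)^`().[0] =
  - 2%:R * tofrac (p * q^`() - q * p^`()).
Proof.
rewrite (deriv_minor (at1_0 p) (at2_0 q) (at1_0 q) (at2_0 p) (deriv_at1_0 p)
                     (deriv_at2_0 q) (deriv_at1_0 q) (deriv_at2_0 p)).
by rewrite chord_limit_eq rmorph_minor.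
Qed.

(** The chord vanishes at [u = 0], where its ends collide; divided by [u], it
    specializes to [- 2] times the tangent. *)
Lemma chord_reduced (p q : {poly R}) : exists2 c : {poly E},
  at1 p * at2 q - at1 q * at2 p = 'X * c & c.[0] = - 2%:R * tofrac (p * q^`() - q * p^`()).
Proof.
have : root (at1 p * at2 q - at1 q * at2 p) 0 by rewrite /root minor_at_0.
case/factor_theorem => c cE; rewrite polyC0 subr0 [c * _]mulrC in cE.
exists c; first exact: cE.
have := deriv_minor_at_0 p q; rewrite cE derivM derivX mul1r hornerD hornerM hornerX.
by rewrite mul0r addr0.
Qed.

(** The chord without its obvious zeros, at [u = 0] and at its two ends.  At
    [u = 0] it specializes to the tangent without its double point.  The leading
    coefficient survives because no fixed point, here the point at infinity of
    the curve, lies on all tangents. *)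
Lemma chord_residual : exists c0 c1 c2 : {poly E}, exists H : {poly {poly E}},
  [/\ [/\ chord0 h1 h2 = 'X * c0, chord1 h0 h2 = 'X * c1 & chord2 h0 h1 = 'X * c2],
      c0 *: map_poly (@cstP R) h0 + c1 *: map_poly (@cstP R) h1
        + c2 *: map_poly (@cstP R) h2 = H * ('X - (pt1 R)%:P) * ('X - (pt2 R)%:P),
      (lead_coef H).[0] != 0
    & let H0 := map_poly (horner_eval 0) H in coprimep H0 H0^`()].
Proof.
have [c0 c0E c00] := chord_reduced h1 h2.
have [c1 c1E c10] := chord_reduced h2 h0.
have [c2 c2E c20] := chord_reduced h0 h1.
pose P := c0 *: map_poly (@cstP R) h0 + c1 *: map_poly (@cstP R) h1
          + c2 *: map_poly (@cstP R) h2.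
have two_neq0E : 2%:R != 0 :> E.
  by rewrite -(rmorph_nat (@cst R)) (inj_rmorph_eq0 (@cst_inj R)).
have [P1 P2] := reduced_minor_root (negbT (polyX_eq0 E)) c0E c1E c2E.
have P1' : P.[pt1 R] = 0 by apply: etrans P1; exact: horner_map_lin3.
have P2' : P.[pt2 R] = 0 by apply: etrans P2; exact: horner_map_lin3.
have pt12 : pt2 R - pt1 R != 0.
  rewrite /pt1 /pt2 -!lock; exact: sub_add_polyX_neq0.
have [H PE] := factor_two_roots P1' P2' pt12.
pose H0 := map_poly (horner_eval 0) H.
have mapc (h : {poly R}) :
    map_poly (horner_eval 0) (map_poly (@cstP R) h) = map_poly (@cst R) h.
  by rewrite -map_poly_comp; apply: eq_map_poly => x; rewrite /= /horner_eval /cstP hornerC.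
have P0 : map_poly (horner_eval 0) P = - 2%:R *: tangent h0 h1 h2.
  apply: etrans (scale_lin3 _ _ _ _ _ _ _).
  apply: etrans (map_lin3 _ _ _ _ _ _ _) _.
  exact: (eq_lin3 c00 c10 c20 (mapc h0) (mapc h1) (mapc h2)).
have k0 : - 2%:R != 0 :> E by rewrite oppr_eq0.
have tangentE : ('X - (gen R)%:P) ^+ 2 * ((- 2%:R)^-1 *: H0) = tangent h0 h1 h2.
  have pt1_0 : (pt1 R).[0] = gen R.
    by rewrite /pt1 -lock hornerD hornerC hornerX addr0.
  have pt2_0 : (pt2 R).[0] = gen R.
    by rewrite /pt2 -lock hornerD hornerN hornerC hornerX subr0.
  apply: scale_square_factor k0 _; rewrite -P0 PE.
  by rewrite !rmorphM /= !map_polyXsubC /= {2 3}/horner_eval pt1_0 pt2_0.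
have cop : coprimep H0 H0^`().
  exact: (coprimep_unscale (tangent_separable wr_neq0 sep tangentE)).
exists c0, c1, c2, H.
split; [by split; [exact: c0E | exact: c1E | exact: c2E] | exact: PE | | exact: cop].
apply/eqP => l0; have lE : lead_coef P = lead_coef H.
  by rewrite PE; exact: lead_coef_two_roots.
set n := (size P).-1.
have e : (c0 * cstP h0`_n + c1 * cstP h1`_n + c2 * cstP h2`_n).[0] = 0.
  apply: etrans l0; rewrite -lE lead_coefE -/n; apply: (congr1 (horner_eval 0)).
  exact: esym (coef_map_lin3 _ _ _ _ _ _ _ _).
have e' : - 2%:R * tofrac (dual0 h1 h2 * (h0`_n)%:P + dual1 h0 h2 * (h1`_n)%:P +
                           dual2 h0 h1 * (h2`_n)%:P) = 0 :> E.
  rewrite -e; apply: etrans (esym (lin3_const _ _ _ _ _ _)) _.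
  exact: (esym (horner_lin3_cst _ _ _ c00 c10 c20)).
move/eqP: e'; rewrite mulf_eq0 (negPf k0) /= tofrac_eq0 => /eqP e'.
have [n0 n1 n2] := dual_perp_const wr_neq0 e'.
have Pn : P`_n = 0.
  apply: etrans (coef_map_lin3 _ _ _ _ _ _ _ _) _.
  by rewrite n0 n1 n2 rmorph0 !mulr0 !addr0.
have H_eq0 : H = 0.
  by apply/eqP; rewrite -lead_coef_eq0 -lE lead_coefE -/n Pn.
by move: cop; rewrite /H0 H_eq0 rmorph0 coprime0p deriv0 eqp01.
Qed.

End Chord.

(** * Separation of the residual roots *)

Lemma eval0_eq0 (E : fieldType) (P : {poly {poly E}}) :
  map_poly (horner_eval 0) P = 0 -> exists Z, P = 'X *: Z.
Proof.
elim/poly_ind: P => [_|P c IHP]; first by exists 0; rewrite scaler0.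
rewrite rmorphD rmorphM /= map_polyX map_polyC /= => e.
have c0 : c.[0] = 0.
  by have := congr1 (fun q : {poly E} => q`_0) e; rewrite coefD coefMX coefC coef0 add0r.
have [|Z ->] := IHP.
  apply/polyP => i; have := congr1 (fun q : {poly E} => q`_i.+1) e.
  by rewrite coefD coefMX coefC addr0 !coef0.
have /factor_theorem[d ->] : root c 0 by apply/rootP.
exists (Z * 'X + d%:P); rewrite scalerDr -scalerAl polyC0 subr0; congr (_ + _).
by rewrite -mul_polyC -polyCM mulrC.
Qed.

Section ResidualRoots.
Variables (E F : fieldType) (g : {rmorphism {poly E} -> F}).
Hypothesis ginj : injective g.
Variable H : {poly {poly E}}.
Hypothesis H_lead : (lead_coef H).[0] != 0.
Hypothesis H_sep : let H0 := map_poly (horner_eval 0) H in coprimep H0 H0^`().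

(** At [u = 0] the residual polynomial is coprime to its derivative, so the value
    of the derivative at a root is a unit modulo [u]; that value is a multiple of
    the distance to any other root. *)
Lemma residual_separated r r' : ev g r H = 0 -> ev g r' H = 0 -> r != r' ->
  exists e z, [/\ loc_int g e, loc_int g z & (r - r') * e = 1 + g 'X * z].
Proof.
move=> Hr Hr' nrr'.
have ir := loc_int_root ginj H_lead Hr; have ir' := loc_int_root ginj H_lead Hr'.
(* The Taylor expansion at [r] bounds the derivative there by [r - r']. *)
have [w iw wE] : exists2 w, loc_int g w & ev g r H^`() = (r - r') * w.
  pose h := r' - r; have r'E : r' = r + h by rewrite /h addrC subrK.
  have h0 : h != 0 by rewrite /h subr_eq0 eq_sym.
  pose w := \sum_(i < size H) ev g r H^`N(i.+2) * h ^+ i.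
  exists w.
    apply: loc_int_sum => i _; apply: loc_int_mul; first exact: loc_int_ev.
    by apply: loc_int_exp; rewrite /h; apply: loc_int_add => //; apply: loc_int_opp.
  have szH : (size (map_poly g H) <= (size H).+2)%N.
    by apply: leq_trans (size_poly _ _) _; rewrite -addn2 leq_addr.
  move: Hr'; rewrite r'E evE (nderiv_taylor_wide (mulrC r h : GRing.comm r h) szH).
  rewrite big_ord_recl big_ord_recl /= /bump /= !add1n nderivn0 -evE Hr mul0r add0r.
  rewrite poly.nderivn1.
  rewrite deriv_map -evE expr1 => e; apply: (mulIf h0).
  have -> : (r - (r + h)) * w * h = - (w * h ^+ 2) by ring.
  apply/eqP; rewrite -addr_eq0; apply/eqP; rewrite -[RHS]e; congr (_ + _).
  rewrite mulr_suml; apply: eq_bigr => i _.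
  by rewrite nderivn_map -evE -mulrA -exprD addn2.
have [[U V] /= UV] := Bezout_eq1_coprimepP _ _ H_sep.
have [Z ZE] : exists Z, map_poly polyC U * H + map_poly polyC V * H^`() - 1 = 'X *: Z.
  apply: eval0_eq0; rewrite rmorphB rmorphD !rmorphM rmorph1 /= -deriv_map.
  have mapC (p : {poly E}) : map_poly (horner_eval 0) (map_poly polyC p) = p.
    by apply/polyP => i; rewrite !coef_map /= /horner_eval hornerC.
  by rewrite !mapC UV subrr.
exists (w * ev g r (map_poly polyC V)), (ev g r Z); split.
- by apply: loc_int_mul => //; apply: loc_int_ev.
- exact: loc_int_ev.
have := congr1 (ev g r) ZE; rewrite -mul_polyC rmorphB rmorphD !rmorphM rmorph1 /=.
rewrite evC Hr mulr0 add0r wE => e.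
by rewrite -e; ring.
Qed.

End ResidualRoots.

(** * A transposition in the Galois group *)

Lemma ev_lin3 (R S T : comNzRingType) (f : {rmorphism R -> S})
    (g : {rmorphism S -> T}) r p0 p1 p2 (q0 q1 q2 : {poly R}) :
  ev g r (p0 *: map_poly f q0 + p1 *: map_poly f q1 + p2 *: map_poly f q2) =
  g p0 * ev (g \o f) r q0 + g p1 * ev (g \o f) r q1 + g p2 * ev (g \o f) r q2.
Proof.
by rewrite -!ev_map !evE map_lin3 !hornerD !hornerZ.
Qed.

Lemma ev_comp (R S : comNzRingType) (f : {rmorphism R -> S}) x p q :
  ev f x (p \Po q) = ev f (ev f x q) p.
Proof. by rewrite !evE map_comp_poly horner_comp. Qed.

Section Transposition.
Variables (R : idomainType) (K : fieldType) (phi : {rmorphism R -> K}).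
Hypothesis phi_inj : injective phi.
Variables (a b : K) (h0 h1 h2 : {poly R}).
Hypothesis ab_indep : indep2 phi a b.
Hypothesis ab_gen : forall x, exists P Q : {poly {poly R}},
  x = ev (ev phi a) b P / ev (ev phi a) b Q.
Hypothesis wr_neq0 : wr h0 h1 h2 != 0.
Hypothesis sep : separates_generic [:: h0; h1; h2].
Hypothesis ncr : no_common_root [:: h0; h1; h2].
Hypothesis two_neq0 : 2%:R != 0 :> R.
Variable L : splittingFieldType K.
Local Notation combL := (map_poly (in_alg L) (comb phi a b h0 h1 h2)).
Hypothesis L_split : splittingFieldFor 1 combL {:L}.

Local Notation j := (base phi L).
Local Notation A := (in_alg L a).
Local Notation B := (in_alg L b).
Local Notation incidentL := (incident j A B h0 h1 h2).
Local Notation good := (distinct_roots j A B h0 h1 h2).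

Local Notation j_inj := (@base_inj R K phi phi_inj L).
Local Notation AB_indep := (ab_indepL ab_indep L).
Local Notation two_neq0_L := (two_neq0L phi_inj two_neq0 L).

Lemma comb_separable : separable_poly combL.
Proof.
have [rs rsE _] := L_split; apply: contraT => ncop.
have /dvdp_prod_XsubC[m gE] : gcdp combL combL^`() %| \prod_(z <- rs) ('X - z%:P).
  by rewrite -(eqp_dvdr _ rsE) dvdp_gcdl.
case mE : (mask m rs) gE => [|z s].
  by rewrite big_nil -size_poly_eq1 => g1; rewrite separable_poly.unlock /coprimep g1 in ncop.
rewrite big_cons => gE; have : root (gcdp combL combL^`()) z.
  by rewrite (eqp_root gE) rootM root_XsubC eqxx.
rewrite root_gcd => /andP[/root_combP iz].
have := deriv_comb_neq0 phi_inj ab_indep wr_neq0 ncr iz.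
by rewrite /root => /negPf->.
Qed.

Lemma comb_polyOver1 : combL \is a polyOver 1%VS.
Proof. exact: alg_polyOver. Qed.

Lemma galois_comb : galois 1 {:L}.
Proof.
apply/splitting_galoisField; exists combL.
by split; [exact: comb_polyOver1 | exact: comb_separable | exact: L_split].
Qed.

Lemma gal_eq1 (s : gal_of {:L}) : (forall r, incidentL r -> s r = r) -> s = 1%g.
Proof.
move=> fix_s; have [rs rsE rsL] := L_split.
apply/eqP/gal_eqP => x _; rewrite gal_id.
have sub : (<<1 & rs>> <= fixedField [set s])%VS.
  apply/Fadjoin_seqP; split=> [|z zrs]; first exact: sub1v.
  apply/fixedFieldP; rewrite ?memvf // => _ /set1P ->; apply: fix_s.
  by apply/root_combP; rewrite (eqp_root rsE) root_prod_XsubC.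
have : x \in fixedField [set s] by apply: (subvP sub); rewrite rsL memvf.
by case/mem_fixedFieldP => _; apply; rewrite set11.
Qed.

Section AtPair.
Variables t1 t2 : L.
Hypothesis dt : good t1 t2.
Local Notation E := {fraction {poly R}}.
Local Notation lamEt := (lamE j_inj AB_indep sep ncr two_neq0_L dt).
Local Notation lamt := (lam j_inj AB_indep sep ncr two_neq0_L dt).
Local Notation s := (mid t1 t2).
Local Notation u := (dif t1 t2).

Definition pair_ev : {poly E} -> L := ev lamEt u.
HB.instance Definition _ := GRing.RMorphism.copy pair_ev (ev lamEt u).
Local Notation g := pair_ev.

Lemma pair_ev_inj : injective g.
Proof. exact: dif_inj. Qed.

Lemma pair_evX : g 'X = u.
Proof. exact: evX. Qed.

Lemma pair_ev_cst x : g (cstP x) = j x.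
Proof. exact: ev_cstP. Qed.

Lemma lamtE (p q : {poly E}) : lamt (tofrac p / tofrac q) = g p / g q.
Proof. by rewrite fmorph_div /= !lam_tofrac. Qed.

Definition other r := [/\ incidentL r, r != t1 & r != t2].

Lemma other_residual c0 c1 c2 (H : {poly {poly E}}) :
    chord0 h1 h2 = 'X * c0 -> chord1 h0 h2 = 'X * c1 -> chord2 h0 h1 = 'X * c2 ->
    c0 *: map_poly (@cstP R) h0 + c1 *: map_poly (@cstP R) h1
        + c2 *: map_poly (@cstP R) h2 = H * ('X - (pt1 R)%:P) * ('X - (pt2 R)%:P) ->
  forall r, other r -> ev g r H = 0.
Proof.
move=> e0 e1 e2 PE r [ir nr1 nr2].
have ev_cst h : ev (g \o @cstP R) r h = ev j r h.
  by apply: eq_ev => x; apply: pair_ev_cst.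
have u0 : u != 0.
  by rewrite -pair_evX (inj_rmorph_eq0 pair_ev_inj) polyX_eq0.
have ue c d : c = 'X * d -> u * g d = g c.
  by move=> ->; rewrite rmorphM /= pair_evX.
have P0 : ev g r (H * ('X - (pt1 R)%:P) * ('X - (pt2 R)%:P)) = 0.
  rewrite -PE ev_lin3 !ev_cst; apply: (mulfI u0); rewrite mulr0 !mulrDr !mulrA.
  rewrite (ue _ _ e0) (ue _ _ e1) (ue _ _ e2).
  have -> : g (chord0 h1 h2) = minor j h1 h2 t1 t2 by apply: ev_chord0.
  have -> : g (chord1 h0 h2) = A * minor j h1 h2 t1 t2 by apply: ev_chord1.
  have -> : g (chord2 h0 h1) = B * minor j h1 h2 t1 t2 by apply: ev_chord2.
  set m := minor _ _ _ _ _; have -> (x y z : L) : m * x + A * m * y + B * m * z =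
    m * (x + A * y + B * z) by ring.
  by rewrite ir mulr0.
move: P0; rewrite !rmorphM !rmorphB /= !evX !evC /=.
have -> : g (pt1 R) = t1 by apply: ev_pt1.
have -> : g (pt2 R) = t2 by apply: ev_pt2.
by move/eqP; rewrite !mulf_eq0 !subr_eq0 (negPf nr1) (negPf nr2) !orbF => /eqP.
Qed.

(** The group fixing [s] and [u^2] is the stabilizer of the pair of roots. *)
Definition decomp_field : {subfield L} := <<<<1; s>>; u ^+ 2>>%AS.
Local Notation Gam := 'Gal({:L} / decomp_field)%G.

Lemma decomp_fix_s sg : sg \in Gam -> sg s = s.
Proof.
move=> Gs; apply: (fixed_gal (subvf _) Gs).
exact: (subvP (subv_adjoin _ _) _ (memv_adjoin _ _)).
Qed.

Lemma decomp_u sg : sg \in Gam -> sg u = u \/ sg u = - u.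
Proof.
move=> Gs; have : sg (u ^+ 2) = u ^+ 2.
  by apply: (fixed_gal (subvf _) Gs); rewrite /decomp_field memv_adjoin.
by rewrite rmorphXn /= => /eqP; rewrite eqf_sqr => /orP[] /eqP; [left | right].
Qed.

Lemma t1E : t1 = s + u. Proof. by rewrite (mid_add_dif two_neq0_L). Qed.
Lemma t2E : t2 = s - u. Proof. by rewrite (mid_sub_dif two_neq0_L). Qed.

Lemma decomp_pair sg : sg \in Gam ->
  (sg t1 = t1 /\ sg t2 = t2) \/ (sg t1 = t2 /\ sg t2 = t1).
Proof.
move=> Gs; have es := decomp_fix_s Gs.
have e1 : sg t1 = s + sg u by rewrite [in LHS]t1E rmorphD /= es.
have e2 : sg t2 = s - sg u by rewrite [in LHS]t2E rmorphB /= es.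
by have [eu|eu] := decomp_u Gs; [left | right];
   rewrite e1 e2 eu ?opprK -?t1E -?t2E.
Qed.

Lemma gal_other sg r : sg \in Gam -> other r -> other (sg r).
Proof.
move=> Gs [ir nr1 nr2]; split; first exact: gal_incident.
  by have [[<- _]|[_ <-]] := decomp_pair Gs; rewrite (inj_eq (fmorph_inj _)).
by have [[_ <-]|[<- _]] := decomp_pair Gs; rewrite (inj_eq (fmorph_inj _)).
Qed.

Lemma decomp_fixed_frac x : (forall sg, sg \in Gam -> sg x = x) ->
  exists p q : {poly E}, q != 0 /\ x = g p / g q.
Proof.
move=> fx.
have xM : x \in decomp_field.
  have gal : galois decomp_field {:L}.
    by apply: galoisS galois_comb; rewrite sub1v subvf.
  rewrite -(galois_fixedField gal).
  by apply/fixedFieldP; rewrite ?memvf.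
have val1 : forall y, y \in 1%VS -> same_value phi_inj ab_indep sep ncr two_neq0 dt dt y.
  exact: same_value_base.
have lam_s : lamt (tofrac (gen R)%:P) = s.
  by rewrite lam_tofrac evC /= lamE_gen.
have lam_u : lamt (tofrac 'X) = u by rewrite lam_tofrac evX.
have val2 y : y \in <<1; s>>%VS -> same_value phi_inj ab_indep sep ncr two_neq0 dt dt y.
  case/Fadjoin_polyP => p p1 ->.
  have [q [q1 _]] := same_value_polyOver val1 p1.
  by exists q.[tofrac (gen R)%:P]; rewrite -horner_map q1 /= lam_s.
case/Fadjoin_polyP: xM => p p1 ->.
have [q [q1 _]] := same_value_polyOver val2 p1.
have [n [d [d0 qE]]] := fracE q.[tofrac 'X ^+ 2].
by exists n, d; rewrite -lamtE -qE -horner_map q1 rmorphXn /= lam_u.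
Qed.

Lemma gal_lamE (sg : gal_of {:L}) x : sg s = s -> sg (lamEt x) = lamEt x.
Proof.
move=> es; have [p [q [q0 ->]]] := fracE x.
by rewrite /lamE frac_lift_div // fmorph_div /= !gal_ev es.
Qed.

Lemma swap_in_decomp : exists2 tau, tau \in Gam & tau u = - u.
Proof.
have [it1 it2 n12] := dt.
have dt' : good t2 t1 by split; rewrite 1?eq_sym.
have [tau G1 [e1 e2]] := roots_2transitive phi_inj ab_indep ab_gen sep ncr two_neq0 dt dt'.
have es : tau s = s by rewrite /mid fmorph_div rmorphD rmorph_nat /= e1 e2 addrC.
have eu : tau u = - u.
  by rewrite /dif fmorph_div rmorphB rmorph_nat /= e1 e2 -mulNr opprB.
exists tau => //; rewrite -sub1set galois_connection ?subvf //.
apply/FadjoinP; split; last first.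
  by apply/fixedFieldP; rewrite ?memvf // => _ /set1P->; rewrite rmorphXn /= eu sqrrN.
apply/FadjoinP; split; first exact: sub1v.
by apply/fixedFieldP; rewrite ?memvf // => _ /set1P->.
Qed.

(** Inertia gives a nontrivial element that fixes the other roots; it cannot fix
    [t1] and [t2] too, as the roots generate [L]. *)
Lemma exists_transposition : exists2 sg, sg \in 'Gal({:L} / 1)%g &
  [/\ sg t1 = t2, sg t2 = t1 & forall r, incidentL r -> r != t1 -> r != t2 -> sg r = r].
Proof.
have [c0 [c1 [c2 [H [[e0 e1 e2] PE H_lead H_sep]]]]] := chord_residual wr_neq0 sep two_neq0.
have oH := other_residual e0 e1 e2 PE.
have [tau Gtau tauu] := swap_in_decomp.
have tauE p : tau (g p) = g (p \Po (- 'X)).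
  rewrite /pair_ev map_ev ev_comp rmorphN /= evX tauu; apply: eq_ev => x.
  exact/gal_lamE/decomp_fix_s.
have two_neq0E : 2%:R != 0 :> E.
  by rewrite -(rmorph_nat (@cst R)) (inj_rmorph_eq0 (@cst_inj R)).
apply: NNPP => no_transp.
apply: (inertia_nontrivial pair_ev_inj _ gal_other _ decomp_fixed_frac _ Gtau tauE two_neq0E).
- by move=> r or; apply: (loc_int_root pair_ev_inj H_lead (oH r or)).
- move=> r r' or or'; exact: (residual_separated pair_ev_inj H_lead H_sep (oH r or) (oH r' or')).
- by move=> sg; rewrite /= pair_evX; apply: decomp_u.
move=> sg Gs sg1; apply: NNPP => fixed.
have fix_other r : other r -> sg r = r.
  by move=> or; apply/eqP/negPn/negP => nr; apply: fixed; exists r.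
have G1 : sg \in 'Gal({:L} / 1)%g by apply: (subsetP (galS _ _) _ Gs); rewrite sub1v.
have [[f1 f2]|[f1 f2]] := decomp_pair Gs; last first.
  apply: no_transp; exists sg => //; split=> // r ir n1 n2; exact: fix_other.
case/eqP: sg1; apply: gal_eq1 => r ir.
have [->//|n1] := eqVneq r t1; have [->//|n2] := eqVneq r t2.
exact: fix_other.
Qed.

End AtPair.
End Transposition.

(** * From transpositions to the symmetric group *)

Section FullSymmetric.
Variables (K : fieldType) (L : splittingFieldType K) (p : {poly L}).
Hypothesis p1 : p \is a polyOver 1%VS.
Hypothesis p_split : splittingFieldFor 1 p {:L}.
Hypothesis p_sep : separable_poly p.
Hypothesis transpositions : forall t1 t2, root p t1 -> root p t2 -> t1 != t2 ->
  exists2 s, s \in 'Gal({:L} / 1)%g &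
  [/\ s t1 = t2, s t2 = t1 & forall r, root p r -> r != t1 -> r != t2 -> s r = r].

(** The action on the indices of the roots is faithful because the roots generate
    [L], and onto because the transpositions generate the symmetric group. *)
Lemma full_symmetric_of_transpositions : gal_full_symmetric p (size p).-1.
Proof.
have [rs0 rsE rsL] := p_split.
have sz : size rs0 == (size p).-1 by rewrite (eqp_size rsE) size_prod_XsubC.
pose d := (size p).-1; pose rs : d.-tuple L := Tuple sz.
have urs : uniq rs.
  by rewrite /= -separable_prod_XsubC -(eqp_separable rsE).
have tinj : injective (tnth rs) by apply/tuple_uniqP.
have rootE z : root p z = (z \in rs) by rewrite (eqp_root rsE) root_prod_XsubC.
have gal_root (g : gal_of {:L}) z : z \in rs -> g z \in rs.
  rewrite -!rootE => pz; rewrite -(fixedPoly_gal (sub1v {:L}) _ p1 (x := g)).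
    by rewrite /root horner_map (rootP pz) rmorph0.
  by rewrite gal_kHom ?sub1v // k1AHom.
pose ix (g : gal_of {:L}) i := odflt i [pick k | tnth rs k == g (tnth rs i)].
have ixE g i : tnth rs (ix g i) = g (tnth rs i).
  rewrite /ix; case: pickP => [k /eqP//|no].
  have /tnthP[k kE] := gal_root g _ (mem_tnth i rs).
  by have := no k; rewrite kE eqxx.
have ix_inj g : injective (ix g).
  by move=> i k /(congr1 (tnth rs)); rewrite !ixE => /fmorph_inj/tinj.
pose f g := perm (ix_inj g).
have fE g i : tnth rs (f g i) = g (tnth rs i) by rewrite permE ixE.
have fM : {in 'Gal({:L} / 1)%g &, {morph f : x y / (x * y)%g}}.
  move=> x y _ _; apply/permP => i; apply: tinj.
  by rewrite permM !fE galM ?memvf.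
pose phi := Morphism fM.
exists rs, phi; split; [exact: urs | exact: rsE | by move=> g i _; rewrite /= fE |].
apply/isomP; split.
  apply/subsetP => g /morphpreP[_ /set1P g1]; apply/set1P.
  apply/eqP/gal_eqP => x _; rewrite gal_id.
  have sub : (<<1 & rs0>> <= fixedField [set g])%VS.
    apply/Fadjoin_seqP; split=> [|z zrs]; first exact: sub1v.
    apply/fixedFieldP; rewrite ?memvf // => _ /set1P ->.
    have /tnthP[i ->] : z \in rs by [].
    by rewrite -fE; have -> : f g = 1%g by []; rewrite perm1.
  have : x \in fixedField [set g] by apply: (subvP sub); rewrite rsL memvf.
  by case/mem_fixedFieldP => _; apply; rewrite set11.
apply/eqP; rewrite eqEsubset subsetT; apply/subsetP => s _.
have [ts -> dts] := prod_tpermP s.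
rewrite big_seq; apply: group_prod => t tts.
have neq : t.1 != t.2 := allP dts t tts.
have [||//|g Gg [g1 g2 g3]] := transpositions (t1 := tnth rs t.1) (t2 := tnth rs t.2).
- by rewrite rootE mem_tnth.
- by rewrite rootE mem_tnth.
- by rewrite (inj_eq tinj).
have -> : tperm t.1 t.2 = phi g.
  apply/permP => i; apply: (tinj); rewrite fE.
  case: tpermP => [->|->|/eqP n1 /eqP n2]; [by rewrite g1 | by rewrite g2 |].
  by apply/esym/g3; rewrite ?rootE ?mem_tnth ?(inj_eq tinj).
exact: mem_morphim.
Qed.

End FullSymmetric.

(** * Absorbing parameters into the base ring *)

Section Proportional.
Variables (R : idomainType) (h p q : {poly R}).
Hypothesis wr_neq0 : wr h p q != 0.

(** The relation passes to derivatives, so that [c] and [d] times the Wronskian are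
    determinants with two equal columns up to scaling. *)
Lemma wr_not_proportional c d : c%:P * q = d%:P * p -> c = 0 /\ d = 0.
Proof.
move=> e.
have dP (e0 : R) (t : {poly R}) : (e0%:P * t)^`() = e0%:P * t^`().
  by rewrite derivM derivC mul0r add0r.
have e' : c%:P * q^`() = d%:P * p^`() by rewrite -dP e dP.
have e'' : c%:P * q^`()^`() = d%:P * p^`()^`() by rewrite -dP e' dP.
have W0 x : x%:P * wr h p q = 0 -> x = 0.
  by move/eqP; rewrite mulf_eq0 (negPf wr_neq0) orbF polyC_eq0 => /eqP.
split; apply: W0; rewrite /wr /dual0 /dual1 /dual2.
  rewrite [LHS](_ : _ =
    (p * (c%:P * q^`()) - (c%:P * q) * p^`()) * h^`()^`() +
    ((c%:P * q) * h^`() - h * (c%:P * q^`())) * p^`()^`() +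
    (h * p^`() - p * h^`()) * (c%:P * q^`()^`())); last by ring.
  by rewrite e e' e''; ring.
rewrite [LHS](_ : _ =
    ((d%:P * p) * q^`() - q * (d%:P * p^`())) * h^`()^`() +
    (q * h^`() - h * q^`()) * (d%:P * p^`()^`()) +
    (h * (d%:P * p^`()) - (d%:P * p) * h^`()) * q^`()^`()); last by ring.
by rewrite -e -e' -e''; ring.
Qed.

Lemma wr_neq0_left : p != 0.
Proof.
apply: contraNneq wr_neq0 => ->.
by rewrite /wr /dual0 /dual1 /dual2 !linear0; apply/eqP; ring.
Qed.

End Proportional.

Lemma ev_injP (R : idomainType) (F : fieldType) (f : {rmorphism R -> F}) x :
  injective (ev f x) -> injective f /\ ~ alg_over f x.
Proof.
move=> i; split; first by move=> c d e; apply/polyC_inj/i; rewrite !evC.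
by case=> p p0 /eqP; rewrite (inj_rmorph_eq0 i) (negPf p0).
Qed.

Definition absorb (R : nzRingType) (f0 f1 : {poly R}) : {poly {poly R}} :=
  map_poly polyC f0 + 'X *: map_poly polyC f1.

Lemma absorb_eq0 (R : nzRingType) (p q : {poly R}) : absorb p q = 0 -> p = 0 /\ q = 0.
Proof.
move=> /polyP e.
have c i : p`_i = 0 /\ q`_i = 0.
  have := e i; rewrite /absorb coefD coefZ !coef_map coef0 /= => ei.
  have := congr1 (fun q : {poly R} => q`_0) ei.
  have := congr1 (fun q : {poly R} => q`_1) ei.
  by rewrite !coefD !coefXM !coefC /= add0r addr0.
by split; apply/polyP => i; rewrite coef0; case: (c i).
Qed.

Section Restriction.
Variables (R : idomainType) (F : fieldType) (f : {rmorphism {poly R} -> F}).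
Hypothesis finj : injective f.

Definition restr : R -> F := f \o polyC.
HB.instance Definition _ := GRing.RMorphism.copy restr (f \o polyC).
Local Notation x := (f 'X).

Lemma restr_inj : injective restr.
Proof. by move=> c d /finj/polyC_inj. Qed.

Lemma ev_restr p : ev restr x p = f p.
Proof.
by rewrite -(map_ev polyC f) evE -[map_poly _ p]/(map_poly _ _) -/(p \Po 'X) comp_polyXr.
Qed.

Lemma restr_transc : ~ alg_over restr x.
Proof. by case=> p p0 /eqP; rewrite ev_restr (inj_rmorph_eq0 finj) (negPf p0). Qed.

Lemma ev_lift r h : ev f r (map_poly polyC h) = ev restr r h.
Proof. by rewrite ev_map; apply: eq_ev. Qed.

Lemma ev_absorb r f0 f1 : ev f r (absorb f0 f1) = ev restr r f0 + x * ev restr r f1.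
Proof. by rewrite /absorb rmorphD -mul_polyC rmorphM /= evC !ev_lift. Qed.

End Restriction.

(** Otherwise [x = - c / d] would be algebraic. *)
Lemma transc_lin (R : idomainType) (F : fieldType) (f : {rmorphism R -> F}) x c d :
  injective f -> ~ alg_over f x -> alg_over f c -> alg_over f d ->
  c + x * d = 0 -> c = 0 /\ d = 0.
Proof.
move=> finj tx ac ad e.
have d0 : d = 0.
  apply/eqP/negPn/negP => d0; apply: tx.
  have -> : x = - c / d.
    by apply: (mulIf d0); rewrite divfK //; apply/eqP; rewrite -addr_eq0 addrC e.
  by apply: alg_div => //; apply: alg_opp.
by split=> //; rewrite -e d0 mulr0 addr0.
Qed.

Section Absorb.
Variables (R : idomainType) (f0 f1 h ga gb : {poly R}) (rest : seq {poly R}).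
Hypotheses (ga_rest : ga \in rest) (gb_rest : gb \in rest).
Hypothesis wr_neq0 : wr h ga gb != 0.
Local Notation liftP := (map_poly polyC : {poly R} -> {poly {poly R}}).

(** A common root of the new family is algebraic over [R], being a root of [ga], so
    the transcendental [X] cannot relate [f0] and [f1] there. *)
Lemma absorb_no_common_root : no_common_root (f0 :: f1 :: rest) ->
  no_common_root (absorb f0 f1 :: map liftP rest).
Proof.
move=> ncr F f finj r vanish.
have vr g : g \in rest -> ev (restr f) r g = 0.
  move=> gr; rewrite -ev_lift; apply: vanish.
  by rewrite inE (map_f liftP gr) orbT.
have ar : alg_over (restr f) r.
  by exists ga; [exact: wr_neq0_left wr_neq0 | exact: vr].
have ri := restr_inj finj.
have ah g : alg_over (restr f) (ev (restr f) r g).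
  by apply: alg_ev => // c; apply: alg_base.
have := vanish _ (mem_head _ _); rewrite ev_absorb.
case/(transc_lin ri (restr_transc finj) (ah f0) (ah f1)) => e0 e1.
apply: (ncr F (restr f) ri r) => g; rewrite !inE => /or3P[/eqP->|/eqP->|] //.
exact: vr.
Qed.

(** The proportionality of [ga] and [gb] makes [r] algebraic over [R(s)], over which
    [X] is transcendental; so the relations for [f0 + X f1] hold for [f0] and [f1]
    separately. *)
Lemma absorb_separates : separates_generic (f0 :: f1 :: rest) ->
  separates_generic (absorb f0 f1 :: map liftP rest).
Proof.
move=> sep F f finj s r ts minors.
have ri := restr_inj finj.
pose f' : {rmorphism R -> F} := restr f; pose x := f 'X.
have ts' : ~ alg_over (ev f' x) s.
  case=> p p0 ps; apply: ts; exists p => //; rewrite -ps.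
  by apply: eq_ev => c; apply/esym/ev_restr.
have s_tr : ~ alg_over f' s.
  move=> as'; apply: ts'; apply: alg_over_evW => //; exact: restr_transc.
have si := ev_inj s_tr.
have tx : ~ alg_over (ev f' s) x by move/alg_exchange.
have base c : alg_over (ev f' s) (f' c).
  by rewrite -(evC f' s); apply: alg_base.
have as_ g : alg_over (ev f' s) (ev f' s g) by apply: alg_base.
have m_rest g g' : g \in rest -> g' \in rest ->
    ev f' r g * ev f' s g' = ev f' r g' * ev f' s g.
  move=> gr gr'; rewrite -!ev_lift; apply: minors.
    by rewrite inE (map_f liftP gr) orbT.
  by rewrite inE (map_f liftP gr') orbT.
have ar : alg_over (ev f' s) r.
  pose Q := ev f' s gb *: map_poly f' ga - ev f' s ga *: map_poly f' gb.
  apply: (alg_root si (p := Q)).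
  - apply/negP => /eqP Q0; case/eqP: (wr_neq0_left wr_neq0).
    apply/polyP => i; rewrite coef0.
    have [] // := @wr_not_proportional _ _ _ _ wr_neq0 ga`_i gb`_i.
    apply: (ev_inj s_tr); rewrite !rmorphM /= !evC.
    have := congr1 (fun q : {poly F} => q`_i) Q0.
    rewrite coefB !coefZ !coef_map coef0 /= => /subr0_eq e.
    by rewrite mulrC e mulrC.
  - rewrite /root /Q hornerD hornerN !hornerZ -!evE.
    by rewrite mulrC (m_rest ga gb) // mulrC subrr.
  move=> i; rewrite coefB !coefZ !coef_map.
  by apply: (alg_sub si); apply: (alg_mul si); first [exact: as_ | exact: base].
have ah g : alg_over (ev f' s) (ev f' r g) by apply: alg_ev.
have gas : ev f' s ga != 0 by apply: ev_neq0 => //; apply: wr_neq0_left wr_neq0.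
have [m0 m1] : ev f' r f0 * ev f' s ga = ev f' r ga * ev f' s f0 /\
               ev f' r f1 * ev f' s ga = ev f' r ga * ev f' s f1.
  have := minors _ (liftP ga) (mem_head _ _).
  rewrite inE (map_f liftP ga_rest) orbT !ev_absorb !ev_lift => /(_ isT) e.
  have [] := @transc_lin _ _ _ x (ev f' r f0 * ev f' s ga - ev f' r ga * ev f' s f0)
    (ev f' r f1 * ev f' s ga - ev f' r ga * ev f' s f1) si tx.
  - by apply: (alg_sub si); apply: (alg_mul si); first [exact: as_ | exact: ah].
  - by apply: (alg_sub si); apply: (alg_mul si); first [exact: as_ | exact: ah].
  - by move/eqP: e; rewrite -subr_eq0 => /eqP e; rewrite -[RHS]e /x /f' /=; ring.
  by move=> /subr0_eq-> /subr0_eq->.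
have m g : g \in f0 :: f1 :: rest -> ev f' r g * ev f' s ga = ev f' r ga * ev f' s g.
  rewrite !inE => /or3P[/eqP->|/eqP->|gr] //.
  exact: m_rest.
apply: (sep F f' ri s r s_tr) => g g' gin gin'.
apply: (mulIf gas); rewrite mulrAC (m g gin) -[RHS]mulrAC (m g' gin').
by rewrite -!mulrA [ev f' s g * _]mulrC.
Qed.

Lemma wr_lift p q r : wr (liftP p) (liftP q) (liftP r) = liftP (wr p q r).
Proof.
by rewrite /wr /dual0 /dual1 /dual2 !rmorphD !rmorphM /= !rmorphB /= !rmorphM /= !deriv_map.
Qed.

Lemma wr_absorb : wr f0 ga gb != 0 \/ wr f1 ga gb != 0 ->
  wr (absorb f0 f1) (liftP ga) (liftP gb) != 0.
Proof.
have -> : wr (absorb f0 f1) (liftP ga) (liftP gb) =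
    absorb (wr f0 ga gb) (wr f1 ga gb).
  rewrite /absorb -!wr_lift /wr /dual0 /dual1 /dual2 !derivD !derivZ.
  by rewrite -!mul_polyC; ring.
by case=> w0; apply: contraNneq w0 => /absorb_eq0[e0 e1]; apply/eqP.
Qed.

End Absorb.

(** * Families with any number of parameters *)

(** Algebraic independence over a domain, by adjoining one element at a time to
    the base; only evaluation morphisms of univariate polynomials occur. *)
Fixpoint alg_indep (F : fieldType) (xs : seq F) (R : idomainType)
    (f : {rmorphism R -> F}) : Prop :=
  if xs is x :: xs' then alg_indep xs' (ev f x) else injective f.

Fixpoint rat_gen (F : fieldType) (xs : seq F) (R : idomainType)
    (f : {rmorphism R -> F}) : Prop :=
  if xs is x :: xs' then rat_gen xs' (ev f x)
  else forall y, exists p q, y = f p / f q.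

(** Inertia applies to every pair of distinct roots, so all transpositions occur. *)
Theorem full_symmetric_plane (R : idomainType) (K : fieldType) (phi : {rmorphism R -> K})
    (a b : K) (h0 h1 h2 : {poly R}) (L : splittingFieldType K) :
    alg_indep [:: a; b] phi -> rat_gen [:: a; b] phi -> 2%:R != 0 :> R ->
    no_common_root [:: h0; h1; h2] -> separates_generic [:: h0; h1; h2] ->
    wr h0 h1 h2 != 0 ->
    splittingFieldFor 1 (map_poly (in_alg L) (comb phi a b h0 h1 h2)) {:L} ->
  gal_full_symmetric (map_poly (in_alg L) (comb phi a b h0 h1 h2))
    (size (comb phi a b h0 h1 h2)).-1.
Proof.
move=> /= ind gen two ncr sep wr0 splitL.
have [i1 tb] := ev_injP ind; have [iphi ta] := ev_injP i1.
rewrite -(size_map_poly (in_alg L)); apply: full_symmetric_of_transpositions.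
- exact: comb_polyOver1.
- exact: splitL.
- exact: (comb_separable iphi (conj ta tb) wr0 ncr splitL).
move=> t1 t2 /root_combP i1' /root_combP i2 n12.
have dt : distinct_roots (base phi L) (in_alg L a) (in_alg L b) h0 h1 h2 t1 t2 by split.
have [s Gs [s1 s2 s3]] :=
  exists_transposition iphi (conj ta tb : indep2 phi a b) gen wr0 sep ncr two splitL dt.
exists s => //; split=> // r /root_combP; exact: s3.
Qed.

Definition param_comb (R K : nzRingType) (phi : R -> K) (xs : seq K) (f0 : {poly R})
    (mid : seq {poly R}) : {poly K} :=
  map_poly phi f0 + \sum_(c <- zip xs mid) c.1 *: map_poly phi c.2.

Theorem full_symmetric_family (K : fieldType) (L : splittingFieldType K) (a b : K)
    (xs : seq K) : forall (R : idomainType) (phi : {rmorphism R -> K})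
    (f0 : {poly R}) (mid : seq {poly R}) (ga gb : {poly R}),
  let p := param_comb phi xs f0 mid + (a *: map_poly phi ga + b *: map_poly phi gb) in
    size mid = size xs ->
    alg_indep (xs ++ [:: a; b]) phi -> rat_gen (xs ++ [:: a; b]) phi ->
    2%:R != 0 :> R ->
    no_common_root (f0 :: mid ++ [:: ga; gb]) ->
    separates_generic (f0 :: mid ++ [:: ga; gb]) ->
    (exists2 h, h \in f0 :: mid & wr h ga gb != 0) ->
    splittingFieldFor 1 (map_poly (in_alg L) p) {:L} ->
  gal_full_symmetric (map_poly (in_alg L) p) (size p).-1.
Proof.
elim: xs => [|x xs IHxs] R phi f0 [|f1 mid] ga gb //= szm.
  rewrite /param_comb big_nil addr0 addrA => ind gen two ncr sep [h].
  by rewrite inE => /eqP-> wr0; apply: full_symmetric_plane.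
case: szm => szm ind gen two ncr sep [h hin wr0] splitL.
pose C := map_poly polyC : {poly R} -> {poly {poly R}}.
have mapC q : map_poly (ev phi x) (C q) = map_poly phi q.
  by rewrite /C -map_poly_comp; apply: eq_map_poly => c /=; rewrite evC.
have pE : param_comb phi (x :: xs) f0 (f1 :: mid) + (a *: map_poly phi ga + b *: map_poly phi gb) =
    param_comb (ev phi x) xs (absorb f0 f1) (map C mid) +
      (a *: map_poly (ev phi x) (C ga) + b *: map_poly (ev phi x) (C gb)).
  rewrite !mapC; congr (_ + _); rewrite /param_comb /= big_cons /= addrA; congr (_ + _).
    by rewrite /absorb rmorphD /= map_polyZ /= evX !mapC.
  elim: (xs) (mid) => [|y ys IHys] [|f2 mid'] /=; rewrite ?big_nil // !big_cons /=.
  by rewrite mapC IHys.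
move: splitL; rewrite pE => splitL.
have ga_in : ga \in mid ++ [:: ga; gb] by rewrite mem_cat !inE eqxx orbT.
have gb_in : gb \in mid ++ [:: ga; gb] by rewrite mem_cat !inE eqxx !orbT.
have catE : map C mid ++ [:: C ga; C gb] = map C (mid ++ [:: ga; gb]).
  by rewrite map_cat.
apply: IHxs => //.
- by rewrite size_map.
- by rewrite -polyC_natr polyC_eq0.
- rewrite catE; exact: (absorb_no_common_root ga_in wr0 ncr).
- rewrite catE; exact: (absorb_separates ga_in gb_in wr0 sep).
move: hin; rewrite !inE => /or3P[/eqP hE|/eqP hE|hin].
- exists (absorb f0 f1); first exact: mem_head.
  by apply: wr_absorb; left; rewrite -hE.
- exists (absorb f0 f1); first exact: mem_head.
  by apply: wr_absorb; right; rewrite -hE.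
exists (C h); first by rewrite inE map_f ?orbT.
by rewrite wr_lift map_poly_eq0_id0 ?polyC_eq0 ?lead_coef_eq0.
Qed.

(** * Generic variables *)

Lemma wronskian_wr (R : idomainType) (f g h : {poly R}) :
  wronskian f g h = wr f g h.
Proof.
rewrite /wronskian (expand_det_row _ ord0) !big_ord_recl big_ord0 /cofactor.
do 3! rewrite (expand_det_row _ ord0) !big_ord_recl big_ord0 /cofactor !det_mx11.
rewrite !mxE /= /bump /= /wr /dual0 /dual1 /dual2.
ring.
Qed.

Section Variables.
Variables (n : nat) (k : fieldType).
Local Notation M := {mpoly k[n]}.

Definition isolate (v : 'I_n) : M -> {poly M} :=
  mmap (polyC \o @mpolyC n k) (fun i => if i == v then 'X else ('X_i : M)%:P).
HB.instance Definition _ v := GRing.RMorphism.copy (isolate v)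
  (mmap (polyC \o @mpolyC n k) (fun i => if i == v then 'X else ('X_i : M)%:P)).

Lemma isolateC v c : isolate v c%:MP = (c%:MP)%:P.
Proof. by rewrite /isolate mmapC. Qed.

Lemma isolateX v i : isolate v 'X_i = if i == v then 'X else ('X_i : M)%:P.
Proof. by rewrite /isolate mmapX mmap1U. Qed.

Definition free_of v (m : M) := isolate v m = m%:P.

Section AdjoinVariable.
Variables (R : idomainType) (f : {rmorphism R -> M}).

Lemma isolate_ev v x p : (forall r, free_of v (f r)) ->
  isolate v (ev f x p) = ev (polyC \o f) (isolate v x) p.
Proof. by move=> fv; rewrite map_ev; apply: eq_ev. Qed.

Lemma ev_var_inj v : injective f -> (forall r, free_of v (f r)) ->
  injective (ev f ('X_v : M)).
Proof.
move=> finj fv; apply: raddf_inj => p /(congr1 (isolate v)).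
rewrite rmorph0 isolate_ev // isolateX eqxx evE map_poly_comp -/(_ \Po 'X) comp_polyXr.
by move=> e; apply: (map_inj_poly finj (rmorph0 f)); rewrite rmorph0.
Qed.

Lemma free_of_ev v w p : w != v -> (forall r, free_of v (f r)) ->
  free_of v (ev f ('X_w : M) p).
Proof.
move=> wv fv; rewrite /free_of isolate_ev // isolateX (negPf wv) map_ev.
by [].
Qed.

End AdjoinVariable.

Definition var (i : 'I_n) : mratfun n k := tofrac ('X_i : M).

Lemma eq_alg_indep (F : fieldType) (xs : seq F) (R : idomainType)
  (f g : {rmorphism R -> F}) : f =1 g -> alg_indep xs f -> alg_indep xs g.
Proof.
elim: xs R f g => [|x xs IHxs] R f g efg /=; last by apply: IHxs; apply: eq_ev.
by move=> finj a b; rewrite -!efg => /finj.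
Qed.

Lemma eq_rat_gen (F : fieldType) (xs : seq F) (R : idomainType)
  (f g : {rmorphism R -> F}) : f =1 g -> rat_gen xs f -> rat_gen xs g.
Proof.
elim: xs R f g => [|x xs IHxs] R f g efg /=; last by apply: IHxs; apply: eq_ev.
by move=> gen y; have [p [q ->]] := gen y; exists p, q; rewrite !efg.
Qed.

Lemma ev_tofrac (R : idomainType) (f : {rmorphism R -> M}) v :
  @tofrac M \o ev f ('X_v : M) =1 ev (@tofrac M \o f) (var v).
Proof. by move=> p; rewrite /= (map_ev f (@tofrac M)). Qed.

(** Isolating the variable [v] recovers the coefficients of a polynomial in ['X_v]
    over the polynomials without [v]. *)
Lemma vars_alg_indep (vs : seq 'I_n) (R : idomainType) (f : {rmorphism R -> M}) :
    uniq vs -> injective f -> (forall v r, v \in vs -> free_of v (f r)) ->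
  alg_indep (map var vs) (@tofrac M \o f).
Proof.
elim: vs R f => [|v vs IHvs] R f /= => [_ finj _ a b /eqP|/andP[v_vs uvs] finj fv].
  by rewrite /= tofrac_eq => /eqP/finj.
apply: (eq_alg_indep (ev_tofrac f v)); apply: IHvs => //.
  by apply: ev_var_inj => // r; apply: fv; rewrite mem_head.
move=> w p w_vs; apply: free_of_ev.
  by apply: contraNneq v_vs => ->.
by move=> r; apply: fv; rewrite inE w_vs orbT.
Qed.

(** [M] is the subring generated by [f] and the variables [vs], as an induction
    principle. *)
Definition generates (R : idomainType) (f : R -> M) (vs : seq 'I_n) :=
  forall T : M -> Prop,
    (forall r, T (f r)) -> (forall v, v \in vs -> T 'X_v) ->
    (forall x y, T x -> T y -> T (x + y)) -> (forall x y, T x -> T y -> T (x * y)) ->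
  forall m, T m.

Lemma vars_rat_gen (vs : seq 'I_n) (R : idomainType) (f : {rmorphism R -> M}) :
  generates f vs -> rat_gen (map var vs) (@tofrac M \o f).
Proof.
elim: vs R f => [|v vs IHvs] R f gen /=.
  have surj m : exists r, f r = m.
    apply: (gen (fun m => exists r, f r = m)) => // [r|_ _ [x <-] [y <-]|_ _ [x <-] [y <-]].
    - by exists r.
    - by exists (x + y); rewrite rmorphD.
    - by exists (x * y); rewrite rmorphM.
  move=> y; have [p [q [_ ->]]] := fracE y.
  by have [p' <-] := surj p; have [q' <-] := surj q; exists p', q'.
apply: (eq_rat_gen (ev_tofrac f v)); apply: IHvs => T Tf Tv TD TM.
apply: gen => // [r|w]; first by rewrite -(evC f ('X_v : M)); apply: Tf.
by rewrite inE => /predU1P[->|/Tv//]; rewrite -(evX f ('X_v : M)); apply: Tf.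
Qed.

Lemma generates_mpolyC (vs : seq 'I_n) : (forall i, i \in vs) ->
  generates (@mpolyC n k) vs.
Proof.
move=> all_vs T TC TX TD TM; apply: mpolyind => [|c m p _ _ Tp].
  by rewrite -(mpolyC0 n k); apply: TC.
apply: TD Tp; rewrite -mul_mpolyC; apply: (TM); first exact: TC.
rewrite mpolyXE_id; apply: big_ind; [by rewrite -(mpolyC1 n k); apply: TC | exact: TM | move=> i _].
elim: (m i) => [|e IHe]; first by rewrite expr0 -(mpolyC1 n k); apply: TC.
by rewrite exprS; apply: TM => //; apply: TX.
Qed.

End Variables.

(** * The family of the statement *)

Lemma same_value_add (R : comNzRingType) (p q p' q' P Q P' Q' : R) :
  p * Q = P * q -> p' * Q' = P' * q' ->
  (p * q' + p' * q) * (Q * Q') = (P * Q' + P' * Q) * (q * q').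
Proof.
move=> e e'; rewrite [LHS](_ : _ = (p * Q) * (q' * Q') + (p' * Q') * (q * Q)); last by ring.
by rewrite e e'; ring.
Qed.

(** A common root in any extension is a root of the gcd, which is a constant. *)
Lemma gcd_no_common_root (k : fieldType) (I : finType) (f : I -> {poly k}) (gs : seq {poly k}) :
    (forall i, f i \in gs) -> \big[@gcdp k/0]_i f i %= 1 -> no_common_root gs.
Proof.
move=> fgs g1 F psi _ r vanish.
have rootG : root (map_poly psi (\big[@gcdp k/0]_i f i)) r.
  apply: (big_ind (fun p => root (map_poly psi p) r)); first by rewrite rmorph0 root0.
    by move=> p q pr qr; rewrite gcdp_map root_gcd pr.
  by move=> i _; rewrite /root -evE vanish.
move: rootG; rewrite /root; have := g1; rewrite -size_poly_eq1 => /size_poly1P[c c0 ->].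
by rewrite map_polyC hornerC fmorph_eq0 (negPf c0).
Qed.

(** Rational functions that take the same value at [r] and [s] form a field; it
    contains the ratios of the [f i], hence the parameter itself.  Inverting is
    harmless, as a nonzero function does not vanish at a transcendental [s]. *)
Lemma ratios_separate (k : fieldType) (n : nat) (f : 'I_n.+1 -> {poly k}) (gs : seq {poly k}) :
    (forall i, f i \in gs) -> (forall i, f i != 0) -> no_common_root gs ->
    (forall g, g \in gs -> exists i, g = f i) ->
    (forall x : ratfun k, generated_field (ratios f) x) ->
  separates_generic gs.
Proof.
move=> fgs f0 ncr gsf gen F psi psi_inj s r ts minors.
have fs i : ev psi s (f i) != 0 by apply: ev_neq0.
have m i i' : ev psi r (f i) * ev psi s (f i') = ev psi r (f i') * ev psi s (f i).
  exact: minors.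
have fr i : ev psi r (f i) != 0.
  apply/negP => /eqP r0; apply: (ncr F psi psi_inj r) => g /gsf[i' ->].
  by apply: (mulIf (fs i)); rewrite m r0 !mul0r.
pose same (x : ratfun k) := exists p q : {poly k},
  [/\ x = tofrac p / tofrac q, ev psi r q != 0, ev psi s q != 0
    & ev psi r p * ev psi s q = ev psi s p * ev psi r q].
have ev0 (q : {poly k}) x : ev psi x q != 0 -> q != 0.
  by apply: contraNneq => ->; rewrite rmorph0.
have all_same x : same x.
  elim: (gen x) => {x} [c|_ [i [i' ->]]|x y _ [p [q [-> qr qs e]]] _ [p' [q' [-> qr' qs' e']]]
    |x _ [p [q [-> qr qs e]]]|x y _ [p [q [-> qr qs e]]] _ [p' [q' [-> qr' qs' e']]]
    |x _ [p [q [-> qr qs e]]]].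
  - exists c%:P, 1; rewrite rmorph1 divr1 !rmorph1 !evC !oner_eq0; by split.
  - by exists (f i), (f i'); split=> //; rewrite m mulrC.
  - exists (p * q' + p' * q), (q * q'); split.
    + by rewrite !rmorphD !rmorphM addf_div // tofrac_eq0; [exact: ev0 qr | exact: ev0 qr'].
    + by rewrite rmorphM mulf_neq0.
    + by rewrite rmorphM mulf_neq0.
    + by rewrite !rmorphD !rmorphM /=; apply: same_value_add.
  - exists (- p), q; split=> //; first by rewrite rmorphN mulNr.
    by rewrite !rmorphN !mulNr e.
  - exists (p * p'), (q * q'); split.
    + by rewrite !rmorphM mulf_div.
    + by rewrite rmorphM mulf_neq0.
    + by rewrite rmorphM mulf_neq0.
    + by rewrite !rmorphM /= mulrACA e e' mulrACA.
  have [p0|p0] := eqVneq p 0.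
    exists 0, 1; rewrite p0 !rmorph0 !rmorph1 !mul0r invr0 !oner_eq0; by split.
  have ps : ev psi s p != 0 by apply: ev_neq0.
  exists q, p; split=> //.
  - by rewrite invf_div.
  - by apply: contraTneq qr => pr; move: e; rewrite pr mul0r => /esym/eqP;
       rewrite mulf_eq0 (negPf ps) /= => ->.
  - by rewrite mulrC -e mulrC.
have [p [q [xE qr qs e]]] := all_same (tofrac 'X).
have pE : p = 'X * q.
  have q0 : tofrac q != 0 by rewrite tofrac_eq0; apply: ev0 qs.
  apply/eqP; rewrite -tofrac_eq rmorphM /= xE divfK //.
move: e; rewrite pE !rmorphM /= !evX -!mulrA [ev psi s q * _]mulrC.
by move/(mulIf (mulf_neq0 qr qs)).
Qed.

Lemma mem_generators (T : eqType) (n : nat) (f : 'I_n.+1 -> T) (p q : 'I_n) (vs : seq 'I_n) :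
    (forall i, i \in vs ++ [:: p; q]) ->
  let gs := f ord0 :: [seq f (lift ord0 i) | i <- vs] ++ [:: f (lift ord0 p); f (lift ord0 q)] in
  (forall i, f i \in gs) /\ (forall g, g \in gs -> exists i, g = f i).
Proof.
move=> all_vs gs; split=> [i|g].
  have [i' ->|->] := unliftP ord0 i; last exact: mem_head.
  rewrite inE -[[:: _; _]]/(map (fun i => f (lift ord0 i)) [:: p; q]) -map_cat.
  by rewrite (map_f (fun i => f (lift ord0 i))) ?orbT.
rewrite inE -[[:: _; _]]/(map (fun i => f (lift ord0 i)) [:: p; q]) -map_cat.
by case/predU1P => [->|/mapP[i _ ->]]; [exists ord0 | exists (lift ord0 i)].
Qed.

Lemma wr_swap (R : idomainType) (f g h : {poly R}) : wr g f h = - wr f g h.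
Proof. by rewrite /wr /dual0 /dual1 /dual2; ring. Qed.

Lemma wr_rot (R : idomainType) (f g h : {poly R}) : wr h f g = wr f g h.
Proof. by rewrite /wr /dual0 /dual1 /dual2; ring. Qed.

Lemma wr_diag (R : idomainType) (f h : {poly R}) : wr h f f = 0.
Proof. by rewrite /wr /dual0 /dual1 /dual2; ring. Qed.

(** A nonzero Wronskian has three distinct entries, at least two of which carry a
    parameter; the third one is then moved to the front. *)
Lemma wr_choice (R : idomainType) (n : nat) (f : 'I_n.+1 -> {poly R}) i j l :
    wr (f i) (f j) (f l) != 0 ->
  exists m p q, p != q /\ wr (f m) (f (lift ord0 p)) (f (lift ord0 q)) != 0.
Proof.
have ne h p q : wr (f h) (f (lift ord0 p)) (f (lift ord0 q)) != 0 -> p != q.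
  by apply: contraNneq => ->; rewrite wr_diag.
case: (unliftP ord0 j) => [j' -> | ->].
  case: (unliftP ord0 l) => [l' -> | ->].
    by move=> w; exists i, j', l'; split=> //; apply: ne w.
  case: (unliftP ord0 i) => [i' -> | ->]; last by rewrite wr_swap wr_diag oppr0 eqxx.
  by rewrite -wr_rot => w; exists ord0, i', j'; split=> //; apply: ne w.
case: (unliftP ord0 l) => [l' -> | ->]; last by rewrite wr_diag eqxx.
case: (unliftP ord0 i) => [i' -> | ->]; last by rewrite -wr_rot wr_diag eqxx.
by rewrite wr_swap oppr_eq0 => w; exists ord0, i', l'; split=> //; apply: ne w.
Qed.

Lemma sum_split_pair (V : nmodType) (n : nat) (G : 'I_n -> V) (p q : 'I_n) : p != q ->
  \sum_i G i = \sum_(i <- [seq i <- index_enum 'I_n | (i != p) && (i != q)]) G i + (G p + G q).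
Proof.
move=> npq; rewrite big_filter (bigD1 p) //= (bigD1 q) 1?eq_sym //=.
by rewrite addrA addrC.
Qed.

Lemma generic_comb_param (n : nat) (k : fieldType) (f : 'I_n.+1 -> {poly k}) (p q : 'I_n) :
    p != q ->
  let vs := [seq i <- index_enum 'I_n | (i != p) && (i != q)] in
  let phi := @tofrac {mpoly k[n]} \o @mpolyC n k in
  generic_comb f =
    param_comb phi [seq var k i | i <- vs] (f ord0) [seq f (lift ord0 i) | i <- vs] +
    (var k p *: map_poly phi (f (lift ord0 p)) + var k q *: map_poly phi (f (lift ord0 q))).
Proof.
move=> npq vs phi; rewrite /generic_comb (sum_split_pair _ npq) addrA -/vs.
by rewrite /param_comb zip_map big_map.
Qed.

(** The variables are independent, so no leading terms cancel. *)
Lemma size_generic_comb (n : nat) (k : fieldType) (f : 'I_n.+1 -> {poly k}) :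
  (forall i, f i != 0) ->
  (size (generic_comb f)).-1 = (\max_(i < n.+1) (size (f i)).-1)%N.
Proof.
move=> f0; set d := (\max_(i < n.+1) _)%N.
pose c m : {mpoly k[n]} := ((f ord0)`_m)%:MP + \sum_(i < n) (f (lift ord0 i))`_m *: 'X_i.
have coefE m : (generic_comb f)`_m = tofrac (c m).
  rewrite /generic_comb coefD coef_map_id0 ?/mratC ?mpolyC0 ?tofrac0 // coef_sum.
  rewrite /c rmorphD rmorph_sum; congr (_ + _); apply: eq_bigr => i _.
  rewrite coefZ coef_map_id0 ?/mratC ?mpolyC0 ?tofrac0 // -mul_mpolyC rmorphM /=.
  by rewrite mulrC.
have mc0 m : (c m)@_(0%MM) = (f ord0)`_m.
  rewrite /c mcoeffD mcoeffC eqxx mulr1 raddf_sum big1 ?addr0 // => i _ /=.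
  by rewrite mcoeffZ mcoeffX mnm1_eq0 mulr0.
have mcU m i : (c m)@_(U_(i)) = (f (lift ord0 i))`_m.
  rewrite /c mcoeffD mcoeffC mnm1_eq0 mulr0 add0r raddf_sum (bigD1 i) //=.
  rewrite mcoeffZ mcoeffXU eqxx mulr1 big1 ?addr0 // => i' ne.
  by rewrite mcoeffZ mcoeffXU (negPf ne) mulr0.
have c_neq0 i m : (f i)`_m != 0 -> (generic_comb f)`_m != 0.
  rewrite coefE tofrac_eq0; apply: contraNneq => c0.
  by case: (unliftP ord0 i) => [i' ->|->]; rewrite -?mcU -?mc0 c0 mcoeff0.
have size_le : (size (generic_comb f) <= d.+1)%N.
  apply/leq_sizeP => m dm; rewrite coefE /c.
  have z i : (f i)`_m = 0.
    apply: nth_default; apply: leq_trans dm.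
    by rewrite -(prednK (_ : 0 < size (f i))%N) ?size_poly_gt0 // ltnS (leq_bigmax i).
  by rewrite z mpolyC0 add0r big1 ?tofrac0 // => i _; rewrite z scale0r.
have [i0 dE] : {i0 | d = (size (f i0)).-1} by apply: eq_bigmax; rewrite card_ord.
have size_gt : (d < size (generic_comb f))%N.
  have fd : (f i0)`_d != 0 by rewrite dE -lead_coefE lead_coef_eq0 f0.
  rewrite ltnNge; apply/negP => le_d.
  by have := c_neq0 _ _ fd; rewrite nth_default // eqxx.
by have -> : size (generic_comb f) = d.+1 by apply/eqP; rewrite eqn_leq size_le.
Qed.

Theorem corollary1p4 (k : fieldType) (n : nat) (f : 'I_n.+1 -> {poly k})
    (L : splittingFieldType (mratfun n k))
    (char_k : 2%N \notin [pchar k])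
    (n_ge2 : (2 <= n)%N)
    (f_neq0 : forall i, f i != 0)
    (gcd_f : \big[@gcdp k/0]_(i < n.+1) f i %= 1)
    (L_split : splittingFieldFor 1
                 (map_poly (in_alg L) (generic_comb f)) {:L})
    (f_gen : forall x : ratfun k, generated_field (ratios f) x)
    (f_wronsk : exists i j l, wronskian (f i) (f j) (f l) != 0) :
  gal_full_symmetric (map_poly (in_alg L) (generic_comb f))
    (\max_(i < n.+1) (size (f i)).-1).
Proof.
have [i [j [l]]] := f_wronsk; rewrite wronskian_wr => /wr_choice[m [p [q [npq w]]]].
rewrite -(size_generic_comb f_neq0).
pose vs := [seq i <- index_enum 'I_n | (i != p) && (i != q)].
have all_vs v : v \in vs ++ [:: p; q].
  by rewrite mem_cat mem_filter mem_index_enum andbT !inE -negb_or orNb.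
have uvs : uniq (vs ++ [:: p; q]).
  rewrite cat_uniq filter_uniq ?index_enum_uniq //= inE npq andbT orbF.
  by rewrite !mem_filter !eqxx andbF.
have [fgs gsf] := mem_generators f all_vs.
have ncr := gcd_no_common_root fgs gcd_f.
have sep := ratios_separate fgs f_neq0 ncr gsf f_gen.
pose phi0 : {rmorphism k -> {mpoly k[n]}} := @mpolyC n k.
have genE := generic_comb_param f npq; rewrite -/vs /= in genE.
move: L_split; rewrite genE => L_split.
have var_cat : [seq var k i | i <- vs] ++ [:: var k p; var k q] = [seq var k i | i <- vs ++ [:: p; q]].
  by rewrite map_cat.
apply: (@full_symmetric_family _ L _ _ _ _ (@tofrac {mpoly k[n]} \o @mpolyC n k)) => //.
- by rewrite !size_map.
- rewrite var_cat; apply: vars_alg_indep uvs _ _; first exact: can_inj (@mpolyCK n k).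
  by move=> v r _; apply: isolateC.
- rewrite var_cat; apply: vars_rat_gen; exact: generates_mpolyC.
exists (f m) => //; move: w; case: (unliftP ord0 m) => [m' ->|->] w; last exact: mem_head.
rewrite inE (map_f (fun i => f (lift ord0 i))) ?orbT // mem_filter mem_index_enum andbT.
apply/andP; split; apply: contraNneq w => ->.
  by rewrite 2!wr_rot wr_diag.
by rewrite wr_rot wr_diag.
Qed.
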